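(* Let $\bar v=(\bar K,\bar L,\bar B,\bar x_{1,0})$ be a stationary point of the transformed reduced functional $\hat{\mathcal{J}}$ (i.e. $\nabla\hat{\mathcal{J}}(\bar v)=0$). Then $\bar v$ satisfies the optimality condition $$0=\nabla_K\hat{\mathcal{J}}(\bar v)=\nabla_K\mathcal{J}_2(\bar v)+\int_0^T\bar p(t)\otimes\bar x(t)\,\mathrm{d}t-\int_0^T\bar x(t)\otimes\bar p(t)\,\mathrm{d}t,$$ $$0=\nabla_L\hat{\mathcal{J}}(\bar v)=\nabla_L\mathcal{J}_2(\bar v)-\Big(\int_0^T\bar p(t)\otimes\bar x(t)\,\mathrm{d}t+\int_0^T\bar x(t)\otimes\bar p(t)\,\mathrm{d}t\Big)\bar L,$$ $$0=\nabla_B\mathcal{J}_2(\bar v)+\int_0^T\big(\bar p(t)\otimes u(t)+\bar x(t)\otimes(\bar y(t)-y_{\rm data}(t))\big)\,\mathrm{d}t,$$ $$0=\nabla_{x_{1,0}}\mathcal{J}_2(\bar v)+\bar p_1(0),$$ where $\bar p$ satisfies the adjoint equation $$-E\frac{\mathrm{d}}{\mathrm{d}t}\bar p=(\bar K^\top-\bar K-\bar L\bar L^\top)\bar p+\bar B(\bar y-y_{\rm data}),\qquad \bar p_1(T)=0,$$ and $\bar x$ satisfies the state equation with output $\bar y$ given by $$E\frac{\mathrm{d}}{\mathrm{d}t}\bar x=(\bar K-\bar K^\top-\bar L\bar L^\top)\bar x+\bar Bu,\qquad \bar x_1(0)=\bar x_{1,0},\qquad \bar y=\bar B^\top\bar 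x.$$
   Context: Fix $T>0$, dimensions $m\ge1$ and $1\le r\le n$, a parameter $\lambda\ge0$, an input $u\in C^1([0,T],\mathbb{R}^m)$, data $y_{\rm data}\in L^2((0,T),\mathbb{R}^m)$, and reference data $w_{\rm ref}\in W$, where $$W=\mathbb{R}^{n\times n}\times\mathbb{R}^{n\times n}\times\mathbb{R}^{n\times m}\times\mathbb{R}^r$$ carries the Euclidean (Frobenius) norm $|\cdot|$. Let $E=\mathrm{diag}(I_r,0)\in\mathbb{R}^{n\times n}$. Vectors $x\in\mathbb{R}^n$ are split as $x=(x_1,x_2)$ with $x_1\in\mathbb{R}^r$, $x_2\in\mathbb{R}^{n-r}$, and $n\times n$ matrices are partitioned into blocks accordingly, with $(\cdot)_{22}$ the lower-right $(n-r)\times(n-r)$ block. For vectors $a,b$, $a\otimes b=ab^\top$. Port-Hamiltonian matrices are parametrized by $J=K-K^\top$ (skew-symmetric) and $R=LL^\top$ (symmetric positive semi-definite) with $K,L\in\mathbb{R}^{n\times n}$ arbitrary. The parameters $v=(K,L,B,x_{1,0})\in W$ considered are those for which the index-1 condition holds, i.e. $J_{22}-R_{22}=(K-K^\top-LL^\top)_{22}$ is invertible (an open subset of $W$; no condition if $r=n$). For such $v$ the state equation $$E\dot x=(K-K^\top-LL^\top)x+Bu,\qquad x_1(0)=x_{1,0},$$ has a unique solution $x=x_v\in H^1((0,T),\mathbb{R}^n)$ (the initial value of $x_2$ is determined by the algebraic rows). With $w(v)=(K-K^\top,LL^\top,B,x_{1,0})$, set $$\mathcal{J}_2(v)=\frac{\lambda}{2}|w(v)-w_{\rm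 ref}|^2,\qquad \hat{\mathcal{J}}(v)=\frac12\int_0^T|B^\top x_v(t)-y_{\rm data}(t)|^2\,\mathrm{d}t+\mathcal{J}_2(v).$$ The functional $\hat{\mathcal J}$ is the transformed reduced cost functional, to be minimized over $v$. Gradients $\nabla_K,\nabla_L,\nabla_B,\nabla_{x_{1,0}}$ are the partial gradients with respect to the Frobenius inner product on matrices and the Euclidean inner product on $\mathbb{R}^r$. The adjoint equation is a differential-algebraic equation solved backward in time, with solution $p=(p_1,p_2)$, $p_1\in H^1((0,T),\mathbb{R}^r)$, $p_2\in L^2((0,T),\mathbb{R}^{n-r})$, satisfied almost everywhere (the term $E\frac{\mathrm{d}}{\mathrm{d}t}p$ involves only $p_1$). *)

(* Defs.v *)
From HB Require Import structures.
From mathcomp Require Import all_boot all_order all_algebra.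
From mathcomp Require Import all_classical all_reals all_analysis.

Set Implicit Arguments.
Unset Strict Implicit.
Unset Printing Implicit Defensive.

Import Order.TTheory GRing.Theory Num.Theory.
Import numFieldNormedType.Exports.

Local Open Scope classical_set_scope.
Local Open Scope ring_scope.

Definition frob (R : realType) (p q : nat) (A B : 'M[R]_(p, q)) : R :=
  \tr (A^T *m B).

Definition fnorm (R : realType) (p q : nat) (A : 'M[R]_(p, q)) : R :=
  Num.sqrt (frob A A).

Definition outer (R : realType) (p q : nat) (a : 'cV[R]_p) (b : 'cV[R]_q) :
  'M[R]_(p, q) := a *m b^T.

(* The differential ['d f x] does not depend on which of the equivalent norms
   carries the topology of V; only the inner product [dot] fixes the gradient. *)
Definition grad (R : realType) (V : normedModType R) (dot : V -> V -> R)
    (f : V -> R) (x : V) : V :=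
  get [set g : V | forall h : V, 'd f x h = dot g h].

(* The entrywise integral of F over [0, t]. *)
Definition mint (R : realType) (p q : nat) (t : R) (F : R -> 'M[R]_(p, q)) :
  'M[R]_(p, q) :=
  \matrix_(i, j) (\int[@lebesgue_measure R]_(z in `[0, t]) F z i j).

Definition L2 (R : realType) (p q : nat) (T : R) (F : R -> 'M[R]_(p, q)) :
  Prop :=
  forall i j,
    ((fun t : measurableTypeR R => F t i j) \_ `[0, T]%classic)
      \in Lfun (@lebesgue_measure R) 2%:E.

(* f is the (absolutely) continuous representative on [0, T] of an element of
   H^1(0, T) whose weak derivative is df. Both functions are unconstrained
   outside [0, T]. *)
Definition H1 (R : realType) (p q : nat) (T : R)
    (f df : R -> 'M[R]_(p, q)) : Prop :=
  L2 T df /\ forall t : R, t \in `[0, T] -> f t = f 0 + mint t df.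

(* C^1 on the closed interval: the derivative on ]0, T[ extends continuously
   to [0, T]. *)
Definition C1 (R : realType) (p : nat) (T : R) (f : R -> 'cV[R]_p) : Prop :=
  derivable_oo_LRcontinuous f 0 T /\
  exists df : R -> 'cV[R]_p,
    {within `[0, T], continuous df} /\ {in `]0, T[, (f^`())%classic =1 df}.

(* Throughout, n = r + s: the state splits as x = (x_1, x_2) with
   x_1 = usubmx x of size r and x_2 = dsubmx x of size s = n - r. *)
Definition W (R : realType) (m r s : nat) : normedModType R :=
  ('M[R]_(r + s) * 'M[R]_(r + s) * 'M[R]_(r + s, m) * 'cV[R]_r)%type.

Section PortHamiltonian.
Context (R : realType) (m r s : nat).
Implicit Types (v w : W R m r s).

Definition vK v : 'M[R]_(r + s) := v.1.1.1.
Definition vL v : 'M[R]_(r + s) := v.1.1.2.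
Definition vB v : 'M[R]_(r + s, m) := v.1.2.
Definition vx v : 'cV[R]_r := v.2.

Definition wdot w w' : R :=
  frob (vK w) (vK w') + frob (vL w) (vL w') + frob (vB w) (vB w')
  + frob (vx w) (vx w').

Definition wnorm w : R := Num.sqrt (wdot w w).

Definition gradK (f : W R m r s -> R) v : 'M[R]_(r + s) :=
  grad (@frob R _ _) (fun K => f (K, vL v, vB v, vx v)) (vK v).
Definition gradL (f : W R m r s -> R) v : 'M[R]_(r + s) :=
  grad (@frob R _ _) (fun L => f (vK v, L, vB v, vx v)) (vL v).
Definition gradB (f : W R m r s -> R) v : 'M[R]_(r + s, m) :=
  grad (@frob R _ _) (fun B => f (vK v, vL v, B, vx v)) (vB v).
Definition gradx (f : W R m r s -> R) v : 'cV[R]_r :=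
  grad (@frob R _ _) (fun x => f (vK v, vL v, vB v, x)) (vx v).

Definition matE : 'M[R]_(r + s) := block_mx 1%:M 0 0 0.

Definition matA v : 'M[R]_(r + s) := vK v - (vK v)^T - vL v *m (vL v)^T.

Definition index1 v : Prop := drsubmx (matA v) \in unitmx.

Definition is_state (T : R) (u : R -> 'cV[R]_m) v
    (x : R -> 'cV[R]_(r + s)) : Prop :=
  exists dx : R -> 'cV[R]_(r + s),
    [/\ H1 T x dx,
        (\forall t \ae @lebesgue_measure R, t \in `[0, T] ->
           matE *m dx t = matA v *m x t + vB v *m u t)
      & usubmx (x 0) = vx v].

(* Meaningful on [0, T] when index1 v holds; arbitrary otherwise. *)
Definition state (T : R) (u : R -> 'cV[R]_m) v : R -> 'cV[R]_(r + s) :=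
  get [set x | is_state T u v x].

(* Only the rows of dp belonging to p_1 matter, since E kills the others. *)
Definition is_adjoint (T : R) (ydata : R -> 'cV[R]_m) v (y : R -> 'cV[R]_m)
    (p : R -> 'cV[R]_(r + s)) : Prop :=
  exists dp : R -> 'cV[R]_(r + s),
    [/\ H1 T (fun t => usubmx (p t)) (fun t => usubmx (dp t)),
        L2 T (fun t => dsubmx (p t)),
        (\forall t \ae @lebesgue_measure R, t \in `[0, T] ->
           - (matE *m dp t) =
           ((vK v)^T - vK v - vL v *m (vL v)^T) *m p t
           + vB v *m (y t - ydata t))
      & usubmx (p T) = 0].

Definition w_of v : W R m r s :=
  (vK v - (vK v)^T, vL v *m (vL v)^T, vB v, vx v).

Definition J2 (lam : R) (wref : W R m r s) v : R :=
  lam / 2 * wnorm (w_of v - wref) ^+ 2.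

Definition Jhat (T lam : R) (u ydata : R -> 'cV[R]_m) (wref : W R m r s) v : R :=
  2^-1 * (\int[@lebesgue_measure R]_(t in `[0, T])
            fnorm ((vB v)^T *m state T u v t - ydata t) ^+ 2)
  + J2 lam wref v.

Definition stationary (f : W R m r s -> R) v : Prop := grad wdot f v = 0.

End PortHamiltonian.

(* Main.v *)
Require Import Defs.
From HB Require Import structures.
From mathcomp Require Import all_boot all_order all_algebra.
From mathcomp Require Import all_classical all_reals all_analysis.
From mathcomp Require Import measurable_realfun ring lra.

Set Implicit Arguments.
Unset Strict Implicit.
Unset Printing Implicit Defensive.

Import Order.TTheory GRing.Theory Num.Theory.
Import numFieldNormedType.Exports.

Local Open Scope classical_set_scope.
Local Open Scope ring_scope.

(* Write A(v) = K - K^T - L L^T, x and x' for the states at v and v + h, and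
   d = x' - x. Then E d' = A(v) d + g with g = (A(v + h) - A(v)) x' + h_B u, so
   pairing d with the adjoint state p and integrating by parts gives exactly
     int B (y - y_data) . d = p_1(0) . h_x + int p . g.
   The cost difference is thus an explicit expression in p, x and d whose part
   linear in h, with d dropped, is the claimed gradient; no linearized state is
   needed. The rest is O(|h|^2) as soon as |d| = O(|h|) uniformly on [0, T].
   This bound and the solvability of both equations come from eliminating the
   algebraic variables and solving a Volterra equation by Picard iteration in a
   weighted sup norm; p_1 is only the primitive of an L^2 function, so the
   integration by parts is proved for primitives of integrable functions. *)

(** * Integration on a bounded interval *)

(** Functions of two qualities meet in every pairing. [ydata], hence the misfit and the algebraic
    part of p, is only square integrable, whereas u of class C^1 makes every state continuous. The
    calculus is therefore built on products of an integrable function ([sL1], [L1]) with a bounded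
    measurable one ([sbounded], [mbounded]). Both equations are used in an integral form, [dae_sol],
    that holds at every time; almost everywhere statements occur only in the passage to and from
    [is_state] and [is_adjoint]. ['d], [grad] and [state] return default values where no derivative
    or solution exists. Differentiability thus has to be proved together with the gradient formula,
    and only on a ball around v where the index-1 condition persists; the quadratic remainder
    [qdiff] delivers both. *)

Section ScalarIntegrals.
Context (R : realType) (T : R).
Hypothesis T0 : 0 < T.
Implicit Types (f g : R -> R) (a b t : R).
Local Notation mu := (@lebesgue_measure R).

Definition sL1 f := mu.-integrable `[0, T] (EFin \o f).

Definition sbounded f := measurable_fun `[0, T] f /\
  exists M : R, forall t, t \in `[0, T] -> `|f t| <= M.

Definition sint t f : R := \int[mu]_(s in `[0, t]) f s.

Let mitv t : measurable (`[0, t]%classic : set (measurableTypeR R)).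
Proof. exact: measurable_itv. Qed.

Lemma sL1_sub f t : sL1 f -> t \in `[0, T] -> mu.-integrable `[0, t] (EFin \o f).
Proof.
move=> If /[!in_itv]/= /andP[t0 tT].
apply: integrableS If => //; exact: subset_itvl.
Qed.

Lemma sbounded_near f : sbounded f -> [bounded f t | t in `[0, T]].
Proof.
case=> mf [M hM]; exists M; split; first exact: num_real.
move=> x Mx t /= tT; apply: le_trans (ltW Mx); exact: hM.
Qed.

Lemma lebesgue_measure_seg t : 0 <= t -> mu `[0, t]%classic = t%:E.
Proof.
move=> t0; rewrite -[LHS]/(lebesgue_measure `[0, t]%classic).
rewrite lebesgue_measure_itv/= lte_fin; case: ltP => [_|/= t0'].
  by rewrite -EFinB/= subr0.
by congr EFin; apply/eqP; rewrite eq_le t0 t0'.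
Qed.

Lemma sbounded_sL1 f : sbounded f -> sL1 f.
Proof.
move=> bf; apply: measurable_bounded_integrable => //.
- by rewrite [X in (X < _)%E]lebesgue_measure_seg ?ltry// ltW.
- by case: bf.
- exact: sbounded_near.
Qed.

Lemma sbounded_cst c : sbounded (fun=> c).
Proof. by split; [exact: measurable_cst|exists `|c|]. Qed.

Lemma sboundedD f g : sbounded f -> sbounded g -> sbounded (fun t => f t + g t).
Proof.
move=> [mf [M hM]] [mg [N hN]]; split; first exact: measurable_funD.
exists (M + N) => t tT; apply: le_trans (ler_normD _ _) _.
by apply: lerD; [exact: hM|exact: hN].
Qed.

Lemma sboundedM f g : sbounded f -> sbounded g -> sbounded (fun t => f t * g t).
Proof.
move=> [mf [M hM]] [mg [N hN]]; split; first exact: measurable_funM.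
exists (M * N) => t tT; rewrite normrM.
by apply: ler_pM => //; [exact: hM|exact: hN].
Qed.

Lemma sbounded_sum n (F : 'I_n -> R -> R) :
  (forall i, sbounded (F i)) -> sbounded (fun t => \sum_(i < n) F i t).
Proof.
elim: n F => [|n IH] F hF.
  by under eq_fun do rewrite big_ord0; exact: sbounded_cst.
by under eq_fun do rewrite big_ord_recr/=; apply: sboundedD => //; apply: IH.
Qed.

Lemma eq_sL1 f g : (forall t, t \in `[0, T] -> f t = g t) -> sL1 f -> sL1 g.
Proof.
move=> fg; rewrite /sL1; apply: eq_integrable => // t /set_mem/= tT.
by rewrite fg.
Qed.

Lemma eq_sbounded f g : (forall t, t \in `[0, T] -> f t = g t) -> sbounded f ->
  sbounded g.
Proof.
move=> fg [mf [M hM]]; split.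
  by apply: eq_measurable_fun mf => t /set_mem/= tT; rewrite fg.
by exists M => t tT; rewrite -fg// hM.
Qed.

Lemma sL1D f g : sL1 f -> sL1 g -> sL1 (fun t => f t + g t).
Proof. by move=> If Ig; have := integrableD (mitv T) If Ig. Qed.

Lemma sL1M f g : sL1 f -> sbounded g -> sL1 (fun t => f t * g t).
Proof.
move=> If bg; have := integrableMl (mitv T) If (proj1 bg) (sbounded_near bg).
by apply.
Qed.

Lemma sL1Ml f g : sbounded f -> sL1 g -> sL1 (fun t => f t * g t).
Proof. by move=> bf Ig; under eq_fun do rewrite mulrC; exact: sL1M. Qed.

Lemma sL1N f : sL1 f -> sL1 (fun t => - f t).
Proof.
move=> If; apply: eq_sL1 (sL1M If (sbounded_cst (-1))) => t _.
by rewrite mulrN1.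
Qed.

Lemma sL1_norm f : sL1 f -> sL1 (fun t => `|f t|).
Proof. by move=> /(integrable_abse). Qed.

Lemma sL1_sum n (F : 'I_n -> R -> R) :
  (forall i, sL1 (F i)) -> sL1 (fun t => \sum_(i < n) F i t).
Proof.
elim: n F => [|n IH] F hF.
  by under eq_fun do rewrite big_ord0; exact/sbounded_sL1/sbounded_cst.
by under eq_fun do rewrite big_ord_recr/=; apply: sL1D => //; apply: IH.
Qed.

Lemma sint0 f : sint 0 f = 0.
Proof. by rewrite /sint set_itv1 Rintegral_set1. Qed.

Lemma eq_sint f g t : (forall s, s \in `[0, t] -> f s = g s) -> sint t f = sint t g.
Proof. by move=> fg; apply: eq_Rintegral => s /set_mem/= /fg. Qed.

Lemma sintD f g t : t \in `[0, T] -> sL1 f -> sL1 g ->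
  sint t (fun s => f s + g s) = sint t f + sint t g.
Proof. by move=> tT If Ig; apply: RintegralD => //; exact: sL1_sub. Qed.

Lemma sintB f g t : t \in `[0, T] -> sL1 f -> sL1 g ->
  sint t (fun s => f s - g s) = sint t f - sint t g.
Proof. by move=> tT If Ig; apply: RintegralB => //; exact: sL1_sub. Qed.

Lemma sintZl f c t : t \in `[0, T] -> sL1 f -> sint t (fun s => c * f s) = c * sint t f.
Proof. by move=> tT If; apply: RintegralZl => //; exact: sL1_sub. Qed.

Lemma sint_sum n (F : 'I_n -> R -> R) t : t \in `[0, T] ->
  (forall i, sL1 (F i)) ->
  sint t (fun s => \sum_(i < n) F i s) = \sum_(i < n) sint t (F i).
Proof.
move=> tT; elim: n F => [|n IH] F hF.
  rewrite big_ord0; under [X in sint t X]eq_fun do rewrite big_ord0.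
  by rewrite /sint Rintegral_cst// mul0r.
rewrite big_ord_recr/= -IH// -sintD//; last exact: sL1_sum.
by apply: eq_sint => s _; rewrite big_ord_recr.
Qed.

Lemma sint_cst c t : 0 <= t -> sint t (fun=> c) = c * t.
Proof.
by move=> t0; rewrite /sint Rintegral_cst// [X in fine X]lebesgue_measure_seg.
Qed.

(** The difference of two integrals from 0 is an integral over the half-open interval, so the
    comparison with g is required only there. This lets g be a bound that is known just between a
    and b. *)
Lemma le_sint_diff f g a b : sL1 f -> sL1 g -> 0 <= a -> a <= b -> b <= T ->
  (forall t, t \in `]a, b] -> `|f t| <= g t) ->
  `|sint b f - sint a f| <= sint b g - sint a g.
Proof.
move=> If Ig a0 ab bT fg.
have bI : b \in `[0, T] by rewrite in_itv/= bT (le_trans a0).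
rewrite /sint !Rintegral_itvB ?bnd_simp//; try exact: sL1_sub.
have Hf : mu.-integrable `]a, b] (EFin \o f).
  apply: integrableS (sL1_sub If bI) => //.
  by apply: subset_itvr; rewrite bnd_simp.
have Hg : mu.-integrable `]a, b] (EFin \o g).
  apply: integrableS (sL1_sub Ig bI) => //.
  by apply: subset_itvr; rewrite bnd_simp.
apply: le_trans (le_normr_Rintegral _ Hf) _.
  exact: measurable_itv.
apply: le_Rintegral => //.
  exact: (integrable_abse Hf).
Qed.

Lemma le_sint f g t : sL1 f -> sL1 g -> t \in `[0, T] ->
  (forall t, t \in `[0, T] -> `|f t| <= g t) -> `|sint t f| <= sint t g.
Proof.
move=> If Ig /[!in_itv]/= /andP[t0 tT] fg.
have /= := le_sint_diff If Ig (lexx 0) t0 tT; rewrite !sint0 !subr0; apply => s.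
rewrite in_itv/= => /andP[s0 st]; apply: fg.
by rewrite in_itv/= (ltW s0) (le_trans st).
Qed.

Lemma sint_continuous f : sL1 f -> {within `[0, T], continuous (fun t => sint t f)}.
Proof. by move=> If; apply: parameterized_integral_continuous => //; exact: ltW. Qed.

Lemma continuous_sbounded f : {within `[0, T], continuous f} -> sbounded f.
Proof.
move=> cf; split; first exact: subspace_continuous_measurable_fun.
have [M [_ hM]] := compact_bounded (continuous_compact cf (@segment_compact _ 0 T)).
exists (M + 1) => t tT; apply: (hM (M + 1)); first by rewrite ltrDl.
by exists t.
Qed.

Lemma sbounded_sint f : sL1 f -> sbounded (fun t => sint t f).
Proof. by move=> /sint_continuous/continuous_sbounded. Qed.

End ScalarIntegrals.

(** * Integration by parts for primitives of integrable functions *)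

Section IntegrationByParts.
Context (R : realType) (T : R).
Hypothesis T0 : 0 < T.
Implicit Types (f g D Phi : R -> R) (a b t : R).

(** Replaces the argument that a function with zero derivative is constant, since no derivative of
    [D] is at hand. The increments of [Phi] telescope to a fixed total, so the bounds add up to the
    mesh size times a constant. In the application [Phi] is the primitive of |f|. *)
Lemma vanishing_increments D Phi (C : R) :
  (forall a b, 0 <= a -> a <= b -> b <= T ->
     `|D b - D a| <= C * (b - a) * (Phi b - Phi a)) ->
  D T = D 0.
Proof.
move=> H.
(* Telescope over the uniform partition of mesh T / N.+1 and let N grow. *)
have key N k : (k <= N.+1)%N ->
    `|D (T * k%:R / N.+1%:R) - D 0| <=
    C * (T / N.+1%:R) * (Phi (T * k%:R / N.+1%:R) - Phi 0).
  have N0 : (0 : R) < N.+1%:R by rewrite ltr0n.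
  elim: k => [_|k IH kN].
    by rewrite mulr0 mul0r !subrr normr0 mulr0.
  have := IH (ltnW kN); set a := T * k%:R / _; set b := T * k.+1%:R / _ => IH'.
  have ba : b - a = T / N.+1%:R by rewrite /a /b -mulrBl -mulrBr -natr1 addrAC subrr
    add0r mulr1.
  have := H a b; rewrite ba.
  have -> : 0 <= a by rewrite /a divr_ge0// ?mulr_ge0// ltW.
  have -> : a <= b by rewrite -subr_ge0 ba divr_ge0// ltW.
  have -> : b <= T.
    by rewrite /b ler_pdivrMr// ler_wpM2l ?ler_nat// ltW.
  move=> /(_ isT isT isT) Hab.
  rewrite (_ : D b - D 0 = (D b - D a) + (D a - D 0)); last by ring.
  apply: le_trans (ler_normD _ _) _; apply: le_trans (lerD Hab IH') _.
  by rewrite -mulrDr addrA subrK.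
have key' N : `|D T - D 0| <= C * T * (Phi T - Phi 0) * N.+1%:R^-1.
  have := key N N.+1 (leqnn _); rewrite mulfK ?pnatr_eq0//.
  by move/le_trans; apply; rewrite mulrA mulrAC.
apply/eqP; rewrite -subr_eq0 -normr_le0.
have cv : (fun N => C * T * (Phi T - Phi 0) * N.+1%:R^-1) @ \oo --> (0 : R).
  rewrite -[X in _ --> X](mulr0 (C * T * (Phi T - Phi 0))).
  apply: cvgMr; exact: cvg_harmonic.
rewrite -[leRHS](cvg_lim _ cv)//; apply: limr_ge.
  by apply/cvg_ex; exists 0.
by near=> N; exact: key'.
Unshelve. all: by end_near. Qed.

Lemma sint_by_parts f g : sL1 T f -> sbounded T g ->
  sint T (fun t => f t * sint t g) + sint T (fun t => g t * sint t f) = sint T f *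
    sint T g.
Proof.
move=> If bg; have Ig := sbounded_sL1 T0 bg.
have bF := sbounded_sint T0 If; have bG := sbounded_sint T0 Ig.
have IfG := sL1M If bG; have IgF := sbounded_sL1 T0 (sboundedM bg bF).
case: (bg) => _ [M hM].
have M0 : 0 <= M.
  by have := hM 0; rewrite in_itv/= lexx (ltW T0) => /(_ isT); exact: le_trans.
(* The defect D of the identity on [0, t] changes on [a, b] by at most
   3 M (b - a) times the integral of |f| over [a, b]. *)
pose D t := sint t (fun s => f s * sint s g) + sint t (fun s => g s * sint s f)
            - sint t f * sint t g.
suff : D T = D 0 by rewrite /D !sint0 mul0r addr0 subr0 => /subr0_eq.
apply: (@vanishing_increments D (fun t => sint t (fun s => `|f s|)) (M + M + M)).
move=> a b a0 ab bT.
have aT : a \in `[0, T] by rewrite in_itv/= a0 (le_trans ab).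
have bT' : b \in `[0, T] by rewrite in_itv/= bT (le_trans a0).
pose Phi t := sint t (fun s => `|f s|).
have nf := sL1_norm If.
have dPhi t : t \in `]a, b] -> `|sint t f - sint a f| <= Phi b - Phi a.
  rewrite in_itv/= => /andP[ta tb].
  apply: (@le_trans _ _ (Phi t - Phi a)).
    by apply: (le_sint_diff If nf) => //; [exact: ltW|exact: le_trans bT].
  rewrite lerD2r -subr_ge0; apply: le_trans (normr_ge0 _) (le_sint_diff nf nf _ _ _
    _) => //.
    by rewrite ltW// (le_lt_trans a0).
  by move=> s _; rewrite normr_id.
have dG t : t \in `[a, b] -> `|sint t g - sint a g| <= M * (b - a).
  rewrite in_itv/= => /andP[ta tb].
  apply: (@le_trans _ _ (sint t (fun=> M) - sint a (fun=> M))).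
    apply: (le_sint_diff Ig (sbounded_sL1 T0 (sbounded_cst _ _))) => //; first by lra.
    move=> s.
    by rewrite in_itv/= => /andP[sa st]; apply: hM; rewrite in_itv/=; lra.
  by rewrite !sint_cst ?(le_trans a0)// -mulrBr ler_wpM2l// lerB.
have dF : `|sint b f - sint a f| <= Phi b - Phi a by exact: le_sint_diff If nf a0 ab
  bT _.
pose d1 := sint b (fun s => f s * (sint s g - sint a g)) - sint a (fun s => f s *
  (sint s g - sint a g)).
pose d2 := sint b (fun s => g s * (sint s f - sint a f)) - sint a (fun s => g s *
  (sint s f - sint a f)).
have e1 t : t \in `[0, T] -> sint t (fun s => f s * (sint s g - sint a g)) =
    sint t (fun s => f s * sint s g) - sint a g * sint t f.
  move=> tT; rewrite -(sintZl _ tT If) -(sintB tT IfG); last first.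
    exact: sL1Ml (sbounded_cst _ _) If.
  by apply: eq_sint => s _; ring.
have e2 t : t \in `[0, T] -> sint t (fun s => g s * (sint s f - sint a f)) =
    sint t (fun s => g s * sint s f) - sint a f * sint t g.
  move=> tT; rewrite -(sintZl _ tT Ig) -(sintB tT IgF); last first.
    exact: sL1Ml (sbounded_cst _ _) Ig.
  by apply: eq_sint => s _; ring.
(* With F and G the primitives of f and g, the first-order parts G(a) (F(b) - F(a)) and F(a) (G(b) -
   G(a)) cancel against the increment of F G. Each remaining term has a factor of size M (b - a) and
   one controlled by the increment of [Phi]. *)
have -> : D b - D a = d1 + d2 - (sint b f - sint a f) * (sint b g - sint a g).
  rewrite /D /d1 /d2 !e1// !e2//.
  move: (sint b (fun s => f s * sint s g)) (sint a (fun s => f s * sint s g)) => ? ?.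
  move: (sint b (fun s => g s * sint s f)) (sint a (fun s => g s * sint s f)) => ? ?.
  by move: (sint b f) (sint a f) (sint b g) (sint a g) => *; ring.
have H1 : `|d1| <= M * (b - a) * (Phi b - Phi a).
  apply: (@le_trans _ _ (sint b (fun s => M * (b - a) * `|f s|) -
      sint a (fun s => M * (b - a) * `|f s|))); last first.
    by rewrite !(@sintZl _ T)// -mulrBr.
  apply: (@le_sint_diff _ T) => //.
  - by apply: sL1M => //; apply: sboundedD => //; exact: sbounded_cst.
  - exact: sL1Ml (sbounded_cst _ _) nf.
  - move=> s sab; rewrite normrM mulrC ler_wpM2r//; apply: dG.
    exact: subset_itv_oc_cc sab.
have H2 : `|d2| <= M * (Phi b - Phi a) * (b - a).
  apply: (@le_trans _ _ (sint b (fun s => M * (Phi b - Phi a)) -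
      sint a (fun s => M * (Phi b - Phi a)))); last first.
    by rewrite !sint_cst ?(le_trans a0)// -mulrBr.
  apply: (@le_sint_diff _ T) => //.
  - by apply: (sbounded_sL1 T0); apply: sboundedM => //; apply: sboundedD => //;
    exact: sbounded_cst.
  - exact/sbounded_sL1/sbounded_cst.
  - move=> s sab; rewrite normrM ler_pM//; last exact: dPhi.
    by apply: hM; move: sab; rewrite !in_itv/=; lra.
have H3 : `|(sint b f - sint a f) * (sint b g - sint a g)| <= (Phi b - Phi a) * (M *
  (b - a)).
  by rewrite normrM ler_pM//; apply: dG; rewrite in_itv/= lexx ab.
have E (x y z : R) : x * y * z + x * z * y + z * (x * y) = (x + x + x) * y * z.
  by ring.
rewrite -/(Phi b) -/(Phi a) -E; apply: le_trans (ler_normB _ _) (lerD _ H3).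
exact: le_trans (ler_normD _ _) (lerD H1 H2).
Qed.
End IntegrationByParts.

(** * Maximum norm of matrices *)

Section MatrixNorm.
Context (R : realType).

Lemma mx_norm_entry p q (A : 'M[R]_(p, q)) i j : `|A i j| <= `|A|.
Proof.
rewrite [leRHS]/Num.Def.normr/= mx_normrE.
exact: (le_bigmax _ (fun ij : 'I_p * 'I_q => `|A ij.1 ij.2|) (i, j)).
Qed.

Lemma mx_norm_le p q (A : 'M[R]_(p, q)) c : 0 <= c ->
  (forall i j, `|A i j| <= c) -> `|A| <= c.
Proof.
move=> c0 Ac; rewrite /Num.Def.normr/= mx_normrE.
by apply: bigmax_le => // -[i j] _; exact: Ac.
Qed.

(** The norm is the largest absolute value of an entry and is not submultiplicative; the factor q
    counts the terms in one entry of the product. This is the origin of the dimensions in all later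
    constants. *)
Lemma mx_norm_mul p q k (A : 'M[R]_(p, q)) (B : 'M[R]_(q, k)) :
  `|A *m B| <= q%:R * `|A| * `|B|.
Proof.
apply: mx_norm_le => [|i j]; first by rewrite !mulr_ge0.
rewrite mxE; apply: le_trans (ler_norm_sum _ _ _) _.
rewrite -mulrA mulr_natl -[X in _ *+ X]card_ord -sumr_const.
by apply: ler_sum => l _; rewrite normrM ler_pM// mx_norm_entry.
Qed.

Lemma mx_norm_tr p q (A : 'M[R]_(p, q)) : `|A^T| = `|A|.
Proof.
apply/eqP; rewrite eq_le; apply/andP; split; apply: mx_norm_le => // i j.
  by rewrite mxE mx_norm_entry.
by rewrite -[A]trmxK mxE trmxK mx_norm_entry.
Qed.

Lemma mx_norm_usub p1 p2 q (A : 'M[R]_(p1 + p2, q)) : `|usubmx A| <= `|A|.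
Proof. by apply: mx_norm_le => // i j; rewrite mxE mx_norm_entry. Qed.

Lemma mx_norm_dsub p1 p2 q (A : 'M[R]_(p1 + p2, q)) : `|dsubmx A| <= `|A|.
Proof. by apply: mx_norm_le => // i j; rewrite mxE mx_norm_entry. Qed.

Lemma mx_norm_split p1 p2 q (A : 'M[R]_(p1 + p2, q)) c :
  `|usubmx A| <= c -> `|dsubmx A| <= c -> `|A| <= c.
Proof.
move=> uA dA; apply: mx_norm_le => [|i j]; first exact: le_trans uA.
rewrite -[A]vsubmxK mxE; case: splitP => k _.
  exact: le_trans (mx_norm_entry _ _ _) uA.
exact: le_trans (mx_norm_entry _ _ _) dA.
Qed.

Lemma frobE p q (A B : 'M[R]_(p, q)) : frob A B = \sum_i \sum_j A i j * B i j.
Proof.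
rewrite /frob /mxtrace exchange_big/=; apply: eq_bigr => j _.
by rewrite mxE; apply: eq_bigr => i _; rewrite mxE.
Qed.

Lemma frob_le p q (A B : 'M[R]_(p, q)) :
  `|frob A B| <= (p * q)%:R * (`|A| * `|B|).
Proof.
rewrite frobE; apply: le_trans (ler_norm_sum _ _ _) _.
rewrite natrM -mulrA !mulr_natl -[X in _ *+ X](card_ord p) -sumr_const.
apply: ler_sum => i _; apply: le_trans (ler_norm_sum _ _ _) _.
rewrite -[X in _ *+ X](card_ord q) -sumr_const.
by apply: ler_sum => j _; rewrite normrM ler_pM// mx_norm_entry.
Qed.

End MatrixNorm.

(** * Entrywise integrals of matrix-valued functions *)

Section MatrixIntegrals.
Context (R : realType) (T : R).
Hypothesis T0 : 0 < T.

Definition mbounded p q (F : R -> 'M[R]_(p, q)) :=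
  forall i j, sbounded T (fun t => F t i j).
Definition L1 p q (F : R -> 'M[R]_(p, q)) := forall i j, sL1 T (fun t => F t i j).

Lemma mbounded_L1 p q (F : R -> 'M[R]_(p, q)) : mbounded F -> L1 F.
Proof. by move=> bF i j; apply: sbounded_sL1. Qed.

Lemma eq_mbounded p q (F G : R -> 'M[R]_(p, q)) :
  (forall t, t \in `[0, T] -> F t = G t) -> mbounded F -> mbounded G.
Proof. by move=> FG bF i j; apply: eq_sbounded (bF i j) => t /FG ->. Qed.

Lemma mbounded_cst p q (A : 'M[R]_(p, q)) : mbounded (fun=> A).
Proof. by move=> i j; exact: sbounded_cst. Qed.

Lemma mbounded_bound p q (F : R -> 'M[R]_(p, q)) : mbounded F ->
  exists2 M : R, 0 <= M & forall t, t \in `[0, T] -> `|F t| <= M.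
Proof.
move=> bF.
have /choice [M hM] : forall ij : 'I_p * 'I_q, exists M : R,
    forall t, t \in `[0, T] -> `|F t ij.1 ij.2| <= M.
  by move=> [i j]; case: (bF i j).
exists (\big[Order.max/0]_ij M ij); first exact: bigmax_ge_id.
move=> t tT; apply: mx_norm_le => [|i j]; first exact: bigmax_ge_id.
exact: le_trans (hM (i, j) t tT) (le_bigmax _ _ _).
Qed.

Lemma mbounded_mulmx p q k (F : R -> 'M[R]_(p, q)) (G : R -> 'M[R]_(q, k)) :
  mbounded F -> mbounded G -> mbounded (fun t => F t *m G t).
Proof.
move=> bF bG i j; under eq_fun do rewrite mxE.
by apply: sbounded_sum => l; exact: sboundedM.
Qed.

Lemma L1_mulmx p q k (F : R -> 'M[R]_(p, q)) (G : R -> 'M[R]_(q, k)) :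
  L1 F -> mbounded G -> L1 (fun t => F t *m G t).
Proof.
move=> bF bG i j; under eq_fun do rewrite mxE.
by apply: sL1_sum => // l; exact: sL1M.
Qed.

Lemma L1_mulmxl p q k (F : R -> 'M[R]_(p, q)) (G : R -> 'M[R]_(q, k)) :
  mbounded F -> L1 G -> L1 (fun t => F t *m G t).
Proof.
move=> bF bG i j; under eq_fun do rewrite mxE.
by apply: sL1_sum => // l; exact: sL1Ml.
Qed.

Lemma mbounded_tr p q (F : R -> 'M[R]_(p, q)) : mbounded F ->
  mbounded (fun t => (F t)^T).
Proof. by move=> bF i j; under eq_fun do rewrite mxE; exact: bF. Qed.

Lemma L1_tr p q (F : R -> 'M[R]_(p, q)) : L1 F -> L1 (fun t => (F t)^T).
Proof. by move=> bF i j; under eq_fun do rewrite mxE; exact: bF. Qed.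

Lemma mboundedD p q (F G : R -> 'M[R]_(p, q)) : mbounded F -> mbounded G ->
  mbounded (fun t => F t + G t).
Proof. by move=> bF bG i j; under eq_fun do rewrite mxE; exact: sboundedD. Qed.

Lemma L1D p q (F G : R -> 'M[R]_(p, q)) : L1 F -> L1 G -> L1 (fun t => F t + G t).
Proof. by move=> bF bG i j; under eq_fun do rewrite mxE; exact: sL1D. Qed.

Lemma mboundedN p q (F : R -> 'M[R]_(p, q)) : mbounded F -> mbounded (fun t => - F t).
Proof.
move=> bF i j; under eq_fun do rewrite mxE -mulN1r.
by apply: sboundedM => //; exact: sbounded_cst.
Qed.

Lemma L1N p q (F : R -> 'M[R]_(p, q)) : L1 F -> L1 (fun t => - F t).
Proof. by move=> bF i j; under eq_fun do rewrite mxE; exact: sL1N. Qed.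

Lemma mboundedB p q (F G : R -> 'M[R]_(p, q)) : mbounded F -> mbounded G ->
  mbounded (fun t => F t - G t).
Proof. by move=> bF bG; apply: mboundedD => //; exact: mboundedN. Qed.

Lemma L1B p q (F G : R -> 'M[R]_(p, q)) : L1 F -> L1 G -> L1 (fun t => F t - G t).
Proof. by move=> bF bG; apply: L1D => //; exact: L1N. Qed.

Lemma mbounded_usub p1 p2 q (F : R -> 'M[R]_(p1 + p2, q)) : mbounded F ->
  mbounded (fun t => usubmx (F t)).
Proof. by move=> bF i j; under eq_fun do rewrite mxE; exact: bF. Qed.

Lemma mbounded_dsub p1 p2 q (F : R -> 'M[R]_(p1 + p2, q)) : mbounded F ->
  mbounded (fun t => dsubmx (F t)).
Proof. by move=> bF i j; under eq_fun do rewrite mxE; exact: bF. Qed.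

Lemma L1_usub p1 p2 q (F : R -> 'M[R]_(p1 + p2, q)) : L1 F ->
  L1 (fun t => usubmx (F t)).
Proof. by move=> bF i j; under eq_fun do rewrite mxE; exact: bF. Qed.

Lemma L1_dsub p1 p2 q (F : R -> 'M[R]_(p1 + p2, q)) : L1 F ->
  L1 (fun t => dsubmx (F t)).
Proof. by move=> bF i j; under eq_fun do rewrite mxE; exact: bF. Qed.

Lemma mbounded_col p1 p2 q (F : R -> 'M[R]_(p1, q)) (G : R -> 'M[R]_(p2, q)) :
  mbounded F -> mbounded G -> mbounded (fun t => col_mx (F t) (G t)).
Proof.
by move=> bF bG i j; under eq_fun do rewrite mxE; case: splitP => k _;
  [exact: bF|exact: bG].
Qed.

Lemma mintE p q t (F : R -> 'M[R]_(p,
  q)) i j : mint t F i j = sint t (fun s => F s i j).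
Proof. by rewrite mxE. Qed.

Lemma eq_mint p q t (F G : R -> 'M[R]_(p, q)) :
  (forall s, s \in `[0, t] -> F s = G s) -> mint t F = mint t G.
Proof.
by move=> FG; apply/matrixP => i j; rewrite !mintE; apply: eq_sint => s /FG ->.
Qed.

Lemma mint0 p q (F : R -> 'M[R]_(p, q)) : mint 0 F = 0.
Proof. by apply/matrixP => i j; rewrite mintE sint0 mxE. Qed.

Lemma mbounded_mint p q (F : R -> 'M[R]_(p, q)) : L1 F -> mbounded (fun t => mint t F).
Proof.
move=> iF i j; apply: eq_sbounded (sbounded_sint T0 (iF i j)) => t _.
by rewrite mintE.
Qed.

Section FixedEndpoint.
Context (t : R) (tT : t \in `[0, T]).

Lemma mintD p q (F G : R -> 'M[R]_(p, q)) : L1 F -> L1 G ->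
  mint t (fun s => F s + G s) = mint t F + mint t G.
Proof.
move=> iF iG; apply/matrixP => i j; rewrite [RHS]mxE !mintE -(sintD tT)//.
by apply: eq_sint => s _; rewrite mxE.
Qed.

Lemma mintB p q (F G : R -> 'M[R]_(p, q)) : L1 F -> L1 G ->
  mint t (fun s => F s - G s) = mint t F - mint t G.
Proof.
move=> iF iG; apply/matrixP => i j; rewrite !mxE -[RHS](sintB tT)//.
by apply: eq_sint => s _; rewrite !mxE.
Qed.

Lemma mint_mull p q k (C : 'M[R]_(p, q)) (F : R -> 'M[R]_(q, k)) : L1 F ->
  mint t (fun s => C *m F s) = C *m mint t F.
Proof.
move=> iF; apply/matrixP => i j; rewrite mintE mxE.
under eq_bigr do rewrite mintE -(sintZl _ tT)//.
rewrite -(sint_sum T0 tT)//; first by apply: eq_sint => s _; rewrite mxE.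
by move=> l; apply: sL1Ml => //; exact: sbounded_cst.
Qed.

Lemma mint_tr p q (F : R -> 'M[R]_(p, q)) : mint t (fun s => (F s)^T) = (mint t F)^T.
Proof.
apply/matrixP => i j; rewrite mintE mxE mintE.
by apply: eq_sint => s _; rewrite mxE.
Qed.

Lemma mint_usub p1 p2 q (F : R -> 'M[R]_(p1 + p2, q)) :
  mint t (fun s => usubmx (F s)) = usubmx (mint t F).
Proof.
apply/matrixP => i j; rewrite mintE mxE mintE.
by apply: eq_sint => s _; rewrite mxE.
Qed.

Lemma mint_dsub p1 p2 q (F : R -> 'M[R]_(p1 + p2, q)) :
  mint t (fun s => dsubmx (F s)) = dsubmx (mint t F).
Proof.
apply/matrixP => i j; rewrite mintE mxE mintE.
by apply: eq_sint => s _; rewrite mxE.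
Qed.

Lemma mint_frob p q (C : 'M[R]_(p, q)) (F : R -> 'M[R]_(p, q)) : L1 F ->
  frob (mint t F) C = sint t (fun s => frob (F s) C).
Proof.
move=> iF; under eq_sint do rewrite frobE; rewrite frobE (sint_sum T0 tT); last first.
  move=> i; apply: sL1_sum => // j; apply: sL1M => //; exact: sbounded_cst.
apply: eq_bigr => i _; rewrite (sint_sum T0 tT); last first.
  by move=> j; apply: sL1M => //; exact: sbounded_cst.
apply: eq_bigr => j _; rewrite mintE mulrC -(sintZl _ tT)//.
by apply: eq_sint => s _; rewrite mulrC.
Qed.

End FixedEndpoint.

(** No dimension factor arises, because both the norm and the integral are taken entry by entry. The
    comparison with the zero function inside the proof gives nonnegativity of the right-hand side,
    which is needed even if the matrix has no entries. *)
Lemma le_mint_diff p q (F : R -> 'M[R]_(p, q)) g a b : L1 F -> sL1 T g ->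
  0 <= a -> a <= b -> b <= T ->
  (forall t, t \in `]a, b] -> `|F t| <= g t) ->
  `|mint b F - mint a F| <= sint b g - sint a g.
Proof.
move=> iF ig a0 ab bT Fg.
have H h : sL1 T h -> (forall t, t \in `]a, b] -> `|h t| <= g t) ->
    `|sint b h - sint a h| <= sint b g - sint a g by move=> *;
      exact: (@le_sint_diff _ T).
apply: mx_norm_le => [|i j].
  apply: le_trans (normr_ge0 _) (H (fun=> 0) _ _);
    first exact/sbounded_sL1/sbounded_cst.
  by move=> t /Fg; rewrite normr0; exact: le_trans.
rewrite !mxE; apply: H => // t /Fg; exact: le_trans (mx_norm_entry _ _ _).
Qed.

End MatrixIntegrals.

(** * Linear Volterra equations *)

Section Volterra.
Context (R : realType) (T : R).
Hypothesis T0 : 0 < T.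

(** For [back] this is the integral over [t, T], so that one theory serves the initial value problem
    of the state and the terminal value problem of the adjoint. *)
Definition vint (back : bool) p q (F : R -> 'M[R]_(p, q)) (t : R) : 'M[R]_(p, q) :=
  if back then mint T F - mint t F else mint t F.

(* Bielecki weight: for k large the Volterra operator is a contraction with
   factor 1/2 on the whole of [0, T] in the weighted sup norm. *)
Definition weight (back : bool) (k t : R) : R := expR (k * (if back then T - t else t)).

Let TT : T \in `[0, T]. Proof. by rewrite in_itv/= lexx ltW. Qed.

Lemma continuous_affine_expR (k d : R) : continuous (fun s : R => expR (k * s + d)).
Proof.
move=> s; apply: continuous_comp; last exact: continuous_expR.
by apply: continuousD; [exact: mulrl_continuous|exact: cst_continuous].
Qed.

Lemma sint_expR (k d t : R) : k != 0 -> 0 <= t ->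
  sint t (fun s => expR (k * s + d)) = (expR (k * t + d) - expR d) / k.
Proof.
move=> k0; rewrite le_eqVlt => /predU1P[<-|t0].
  by rewrite sint0 mulr0 add0r subrr mul0r.
have dF (s : R) : is_derive s (1 : R) (fun s : R => expR (k * s + d) / k) (expR (k *
  s + d)).
  apply: is_derive_eq; rewrite /= ?scaler0 ?addr0 ?add0r ?scaler1 ?mulr1.
  by rewrite /GRing.scale/=; field.
have cf : continuous (fun s : R => expR (k * s + d)) by exact: continuous_affine_expR.
have cF : continuous (fun s : R => expR (k * s + d) / k).
  by move=> s; apply: differentiable_continuous; apply/derivable1_diffP; case: (dF s).
rewrite /sint /Rintegral.
rewrite (@continuous_FTC2 _ _ (fun s : R => expR (k * s + d) / k) _ _ t0)/=.
- by rewrite mulr0 add0r mulrBl.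
- exact: continuous_subspaceT.
- split => [s _||]; first by case: (dF s).
    by apply: cvg_at_right_filter; exact: cF.
  by apply: cvg_at_left_filter; exact: cF.
- by move=> s _; rewrite derive1E; apply: derive_val.
Qed.

Lemma weight_ge1 b k t : 0 <= k -> t \in `[0, T] -> 1 <= weight b k t.
Proof.
rewrite in_itv/= => k0 /andP[t0 tT]; rewrite -expR0 ler_expR mulr_ge0//.
by case: b => //; rewrite subr_ge0.
Qed.

Lemma weight_le b k t : 0 <= k -> t \in `[0, T] -> weight b k t <= expR (k * T).
Proof.
rewrite in_itv/= => k0 /andP[t0 tT]; rewrite ler_expR ler_wpM2l//.
by case: b => //; rewrite lerBlDr lerDl.
Qed.

Lemma sbounded_weight b k : sbounded T (weight b k).
Proof.
apply: continuous_sbounded; apply: continuous_subspaceT.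
have -> : weight b k = fun s => expR ((if b then - k else k) * s +
    (if b then k * T else 0)).
  by apply/funext => s; rewrite /weight; case: b; congr expR; ring.
exact: continuous_affine_expR.
Qed.

(** Integrated in the direction of [b], the weight reproduces itself up to the factor 1/k and an
    endpoint term whose sign allows it to be dropped. *)
Lemma vint_weight b p q (F : R -> 'M[R]_(p, q)) k c : 0 < k -> 0 <= c ->
  L1 T F -> (forall t, t \in `[0, T] -> `|F t| <= c * weight b k t) ->
  forall t, t \in `[0, T] -> `|vint b F t| <= c / k * weight b k t.
Proof.
move=> k0 c0 iF Fc t tT; have /andP[t0 tT'] : 0 <= t <= T by move: tT; rewrite in_itv.
have iw : sL1 T (fun t => c * weight b k t).
  by apply/sbounded_sL1 => //; apply: sboundedM;
    [exact: sbounded_cst|exact: sbounded_weight].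
have iw' : sL1 T (weight b k) by apply/sbounded_sL1 => //; exact: sbounded_weight.
have kn0 : k != 0 by rewrite gt_eqF.
case: b Fc iw iw' => Fc iw iw'.
  apply: le_trans (le_mint_diff T0 iF iw t0 tT' (lexx _) _) _.
    by move=> s /[!in_itv]/= ts; apply: Fc; rewrite in_itv/=; lra.
  rewrite !(@sintZl _ T)// -mulrBr -mulrA ler_wpM2l//.
  have E x : 0 <= x -> sint x (weight true k) = (expR (k * T) - weight true k x) / k.
    move=> x0; transitivity (sint x (fun s => expR ((- k) * s + k * T))).
      by apply: eq_sint => s _; congr expR; rewrite /=; ring.
    rewrite sint_expR ?oppr_eq0// invrN mulrN -mulNr opprB; congr ((_ - expR _) / _).
    by rewrite /=; ring.
  rewrite (E T (ltW T0)) (E t t0) -mulrBl mulrC ler_wpM2l ?invr_ge0 ?(ltW k0)//.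
  by have := expR_ge0 (k * (T - T)); rewrite /weight/=; lra.
apply: (@le_trans _ _ (sint t (fun t => c * weight false k t))).
  have := @le_mint_diff _ _ T0 _ _ _ _ _ _ iF iw (lexx _) t0 tT'.
  rewrite mint0 sint0 !subr0; apply => s /[!in_itv]/= ts.
  by apply: Fc; rewrite in_itv/=; lra.
rewrite (@sintZl _ T)// -mulrA ler_wpM2l//.
have -> : sint t (weight false k) = (weight false k t - 1) / k.
  transitivity (sint t (fun s => expR (k * s + 0))).
    by apply: eq_sint => s _; rewrite addr0.
  by rewrite sint_expR// addr0 expR0.
by rewrite mulrC ler_wpM2l ?invr_ge0 ?(ltW k0)// gerBl.
Qed.

Lemma vintB b p q (F G : R -> 'M[R]_(p, q)) t : t \in `[0, T] ->
  L1 T F -> L1 T G -> vint b (fun s => F s - G s) t = vint b F t - vint b G t.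
Proof.
move=> tT iF iG; rewrite /vint; case: b; rewrite !(mintB (T := T))//.
by rewrite !opprD !opprK addrACA.
Qed.

Lemma eq_vint b p q (F G : R -> 'M[R]_(p, q)) t : t \in `[0, T] ->
  (forall s, s \in `[0, T] -> F s = G s) -> vint b F t = vint b G t.
Proof.
move=> tT FG; rewrite /vint (eq_mint FG) (@eq_mint _ _ _ t F G)// => s /[!in_itv]/= st.
by apply: FG; move: tT; rewrite !in_itv/=; lra.
Qed.

Lemma mbounded_vint b p q (F : R -> 'M[R]_(p, q)) : L1 T F -> mbounded T (vint b F).
Proof.
move=> iF; rewrite /vint; case: b; last exact: mbounded_mint.
by apply: mboundedB; [exact: mbounded_cst|exact: mbounded_mint].
Qed.

Lemma le0_half_expn (x C : R) : (forall k, x <= C * 2^-1 ^+ k) -> x <= 0.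
Proof.
move=> H.
have cv : (fun k => C * 2^-1 ^+ k) @ \oo --> (0 : R).
  apply: (@cvg_geometric _ C 2^-1).
  by rewrite ger0_norm// invf_lt1// ltr1n.
rewrite -[leRHS](cvg_lim _ cv)//; apply: limr_ge.
  by apply/cvg_ex; exists 0.
by near=> N; exact: H.
Unshelve. all: by end_near. Qed.

Lemma geometric_cauchy (u : nat ->
  R) K : (forall k, `|u k.+1 - u k| <= K * 2^-1 ^+ k) ->
  exists l, forall k, `|u k - l| <= 2 * K * 2^-1 ^+ k.
Proof.
(* u - e is nondecreasing, u + e is nonincreasing,
  and the former is below the latter. *)
move=> H; pose e k := 2 * K * 2^-1 ^+ k.
have eS k : e k.+1 = e k - K * 2^-1 ^+ k by rewrite /e exprS; field.
have lo i j : (i <= j)%N -> u i - e i <= u j - e j.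
  move=> /subnK <-; elim: (j - i)%N => // n; move/le_trans; apply.
  by rewrite addSn eS; have := H (n + i)%N; rewrite ler_norml; lra.
have hi i j : (i <= j)%N -> u j + e j <= u i + e i.
  move=> /subnK <-; elim: (j - i)%N => // n; apply: le_trans.
  by rewrite addSn eS; have := H (n + i)%N; rewrite ler_norml; lra.
have e0 k : 0 <= e k.
  have := le_trans (normr_ge0 _) (H k); rewrite /e -mulrA; lra.
have lohi i j : u i - e i <= u j + e j.
  case: (leP i j) => [ij|/ltnW ij].
    by apply: le_trans (lo _ _ ij) _; have := e0 j; lra.
  by apply: le_trans (hi _ _ ij); have := e0 i; lra.
exists (sup (range (fun i => u i - e i))) => k.
have ub : u k - e k <= sup (range (fun i => u i - e i)).
  apply: ub_le_sup; last by exists k.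
  by exists (u 0%N + e 0%N) => _ [i _ <-].
have lb : sup (range (fun i => u i - e i)) <= u k + e k.
  apply: ge_sup; first by exists (u 0%N - e 0%N); exists 0%N.
  by move=> _ [i _ <-].
by rewrite ler_norml -/(e k); lra.
Qed.

End Volterra.

Section VolterraEquation.
Context (R : realType) (T : R).
Hypothesis T0 : 0 < T.
Context (b : bool) (n : nat) (A : 'M[R]_n).

(** Twice the bound n |A| of multiplication by A, so that integration followed by A halves the
    weighted norm; the summand 1 keeps k positive when A = 0. *)
Let k : R := 2 * (n%:R * `|A|) + 1.
Let w := weight T b k.
Let V (z : R -> 'cV[R]_n) t := A *m vint T b z t.

Let k0 : 0 < k.
Proof. by rewrite ltr_wpDl// !mulr_ge0. Qed.

Let w1 t : t \in `[0, T] -> 1 <= w t.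
Proof. by apply: weight_ge1; exact: ltW. Qed.

Let W : R := expR (k * T).

Let wW t : t \in `[0, T] -> w t <= W.
Proof. by apply: weight_le; exact: ltW. Qed.

Let contraction (F : R -> 'cV[R]_n) c : L1 T F -> 0 <= c ->
  (forall t, t \in `[0, T] -> `|F t| <= c * w t) ->
  forall t, t \in `[0, T] -> `|V F t| <= 2^-1 * c * w t.
Proof.
move=> iF c0 Fc t tT; apply: le_trans (mx_norm_mul _ _) _.
have := vint_weight T0 k0 c0 iF Fc tT => /(ler_wpM2l _)/le_trans; apply.
  by rewrite mulr_ge0.
rewrite mulrA ler_wpM2r//; first by rewrite (le_trans _ (w1 tT)).
rewrite mulrCA [leRHS]mulrC ler_wpM2l// ler_pdivrMr// /k; lra.
Qed.

(** A bound |z| <= c w is improved by the equation to |z| <= (M + c / 2) w. Iterating from any bound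
    of z leads to the fixed point 2 M of c -> M + c / 2, and w is at most exp (k T). *)
Lemma volterra_apriori (F z : R -> 'cV[R]_n) M : mbounded T z -> 0 <= M ->
  (forall t, t \in `[0, T] -> z t = F t + A *m vint T b z t) ->
  (forall t, t \in `[0, T] -> `|F t| <= M) ->
  forall t, t \in `[0, T] -> `|z t| <= 2 * expR ((2 * (n%:R * `|A|) + 1) * T) * M.
Proof.
move=> bz M0 zE FM.
have iz := mbounded_L1 T0 bz.
have [c c0 zc] := mbounded_bound bz.
have H i t : t \in `[0, T] -> `|z t| <= (2 * M + c * 2^-1 ^+ i) * w t.
  elim: i t => [|i IH] t tT.
    rewrite mulr1; apply: le_trans (zc _ tT) _.
    rewrite -[leLHS]mulr1 ler_pM// ?w1//; lra.
  rewrite zE//; apply: le_trans (ler_normD _ _) _.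
  have ci0 : 0 <= c * 2^-1 ^+ i by rewrite mulr_ge0// exprn_ge0.
  have := contraction iz _ IH tT => /(_ _)/(lerD (FM _ tT)) VF.
  apply: le_trans (VF _) _; first by lra.
  rewrite exprS [c * (_ * _)]mulrCA.
  have := w1 tT => w1t.
  have : M <= M * w t by rewrite ler_peMr.
  set x := c * _; rewrite mulrDr; lra.
move=> t tT; rewrite -subr_le0; apply: (@le0_half_expn _ _ (c * W)) => i.
rewrite lerBlDr; apply: le_trans (H i t tT) _.
rewrite mulrDl addrC lerD//.
  by rewrite mulrAC ler_wpM2r ?exprn_ge0// ler_wpM2l// wW.
by rewrite mulrAC ler_wpM2r// ler_wpM2l// wW.
Qed.

(** Consecutive Picard iterates differ by a quantity that halves in the weighted norm. Limits are
    chosen for each time and entry, with a rate 2^-i uniform in t: the rate yields boundedness of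
    the limit and the passage to the limit under the integral, while measurability is that of a
    pointwise limit. *)
Lemma volterra_exists (F : R -> 'cV[R]_n) : mbounded T F ->
  exists2 z, mbounded T z & forall t, t \in `[0, T] -> z t = F t + A *m vint T b z t.
Proof.
move=> bF; have [M M0 FM] := mbounded_bound bF.
pose S := fix S i : R -> 'cV[R]_n :=
  if i is j.+1 then (fun t => F t + A *m vint T b (S j) t) else (fun=> 0).
have bS i : mbounded T (S i).
  elim: i => [|i IH]; first exact: mbounded_cst.
  apply: mboundedD => //; apply: mbounded_mulmx; first exact: mbounded_cst.
  exact/mbounded_vint/mbounded_L1.
have iS i := mbounded_L1 T0 (bS i).
have VB (f g : R -> 'cV[R]_n) t : L1 T f -> L1 T g -> t \in `[0, T] ->
    V (fun s => f s - g s) t = V f t - V g t.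
  by move=> If Ig tT; rewrite /V (vintB T0)// mulmxBr.
have dS i t : t \in `[0, T] -> `|S i.+1 t - S i t| <= M * 2^-1 ^+ i * w t.
  elim: i t => [|i IH] t tT.
    have -> : S 1%N t - S 0%N t = F t.
      rewrite /= (_ : vint T b (fun=> 0) t = 0) ?mulmx0 ?addr0 ?subr0//.
      have H : vint T b (fun=> 0 - 0) t = 0 :> 'cV[R]_n.
        rewrite (@vintB _ T T0 b _ _ (fun=> 0) (fun=> 0))// ?subrr//;
          exact/mbounded_L1/mbounded_cst.
      by rewrite -[RHS]H; apply: eq_vint => // s _; rewrite subrr.
    by rewrite mulr1; apply: le_trans (FM _ tT) _; rewrite ler_peMr// w1.
  have -> : S i.+2 t - S i.+1 t = V (fun s => S i.+1 s - S i s) t.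
    by rewrite VB// /V /= opprD addrACA subrr add0r.
  rewrite exprS mulrCA; apply: contraction => //.
    exact: L1B.
  by rewrite mulr_ge0// exprn_ge0.
(* The condition on t stands under the existential quantifier so that one choice function covers all
   reals; the value 0 outside [0, T] is arbitrary. *)
have lim_ex t j : exists l, t \in `[0, T] ->
  forall i, `|S i t j 0 - l| <= 2 * (M * W) * 2^-1 ^+ i.
  have [tT|tT] := boolP (t \in `[0, T]); last by exists 0.
  have [|l hl] := @geometric_cauchy _ (fun i => S i t j 0) (M * W).
    move=> i; have /= := mx_norm_entry (S i.+1 t - S i t) j 0; rewrite !mxE.
    move/le_trans; apply; apply: le_trans (dS _ _ tT) _.
    by rewrite mulrAC ler_wpM2r ?exprn_ge0// ler_wpM2l// wW.
  by exists l.
have /choice [Z hZ] : forall tj : R * 'I_n, exists l, tj.1 \in `[0, T] ->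
   forall i, `|S i tj.1 tj.2 0 - l| <= 2 * (M * W) * 2^-1 ^+ i.
  by move=> [t j]; exact: lim_ex.
pose z t : 'cV[R]_n := \col_j Z (t, j).
pose e i := 2 * (M * W) * 2^-1 ^+ i.
have W0 : 0 <= W by exact: expR_ge0.
have e0 i : 0 <= e i by rewrite !mulr_ge0// exprn_ge0.
have zS i t : t \in `[0, T] -> `|S i t - z t| <= e i.
  move=> tT; apply: mx_norm_le => // j j'.
  by rewrite !mxE (ord1 j'); exact: (hZ (t, j) tT).
have bz : mbounded T z.
  move=> j j'; split.
    apply: (@measurable_fun_cvg _ _ _ _ (fun i t => S i t j j')).
      by move=> i; case: (bS i j j').
    move=> t tT; apply/cvgrPdist_le => /= eps eps0.
    have cv : e @ \oo --> (0 : R).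
      apply: (@cvg_geometric _ _ 2^-1).
      by rewrite ger0_norm// invf_lt1// ltr1n.
    have /cvgrPdist_le/(_ _ eps0) := cv.
    apply: filterS => i; rewrite sub0r normrN => ei.
    rewrite -normrN opprB; apply: le_trans ei.
    apply: le_trans (ler_norm _); apply: le_trans (zS i t tT).
    by have := mx_norm_entry (S i t - z t) j j'; rewrite [X in `|X|]mxE [X in _ + X]mxE.
  have [B _ hB] := mbounded_bound (bS 0%N).
  exists (B + e 0%N) => t tT; apply: le_trans (mx_norm_entry _ _ _) _.
  rewrite -[z t](subrK (S 0%N t)) addrC; apply: le_trans (ler_normD _ _) _.
  by apply: lerD; [exact: hB|rewrite -normrN opprB; exact: zS].
have iz := mbounded_L1 T0 bz.
exists z => // t tT.
apply/eqP; rewrite -subr_eq0 -normr_le0.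
(* The residual of z is compared with the recursion, [S i] being put under the operator and [S i.+1]
   outside it. Each is within O(2^-i) of z; the operator costs a factor 1/2 and the weight at most
   W. *)
apply: (@le0_half_expn _ _ (2 * (M * W) * (2^-1 + 2^-1 * W))) => i.
have -> : z t - (F t + A *m vint T b z t) =
    V (fun s => S i s - z s) t - (S i.+1 t - z t).
  rewrite VB// /V /= opprB addrCA; congr (z t + _).
  by rewrite [RHS]addrC !opprD addrA subrK.
apply: le_trans (ler_normB _ _) _.
have h1 : `|V (fun s => S i s - z s) t| <= 2^-1 * e i * w t.
  apply: contraction => //; first exact: L1B.
  move=> s sT; apply: le_trans (zS _ _ sT) _.
  by rewrite ler_peMr// w1.
have h2 := zS i.+1 t tT.
apply: le_trans (lerD h1 h2) _.
have : 2^-1 * e i * w t <= 2^-1 * e i * W.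
  by rewrite ler_wpM2l ?wW// mulr_ge0.
by rewrite /e exprS; set x := 2^-1 ^+ i; lra.
Qed.

End VolterraEquation.

(** * Index-1 differential-algebraic equations *)

Section DAE.
Context (R : realType) (T : R).
Hypothesis T0 : 0 < T.
Context (r s : nat).

Lemma usub_mulmx (A : 'M[R]_(r + s)) (z : 'cV[R]_(r + s)) :
  usubmx (A *m z) = ulsubmx A *m usubmx z + ursubmx A *m dsubmx z.
Proof.
by rewrite -{1}[A]submxK -{1}[z]vsubmxK mul_block_col col_mxKu.
Qed.

Lemma dsub_mulmx (A : 'M[R]_(r + s)) (z : 'cV[R]_(r + s)) :
  dsubmx (A *m z) = dlsubmx A *m usubmx z + drsubmx A *m dsubmx z.
Proof.
by rewrite -{1}[A]submxK -{1}[z]vsubmxK mul_block_col col_mxKd.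
Qed.

(* Integral form of E z' = A z + g, z_1(0) = z0; for [back = true], of the
   backward equation - E z' = A z + g, z_1(T) = z0. *)
Definition dae_sol (back : bool) (A : 'M[R]_(r + s)) (g : R -> 'cV[R]_(r + s))
    (z0 : 'cV[R]_r) (z : R -> 'cV[R]_(r + s)) :=
  forall t, t \in `[0, T] ->
    usubmx (z t) = z0 + vint T back (fun t => usubmx (A *m z t + g t)) t /\
    dsubmx (A *m z t + g t) = 0.

Context (b : bool) (A : 'M[R]_(r + s)).
Hypothesis A22 : drsubmx A \in unitmx.

Let iA22 := invmx (drsubmx A).
(** Schur complement of the algebraic block: the matrix of the ordinary differential equation that
    remains for z_1 once z_2 is eliminated. [red] is the source of that equation. *)
Let At := ulsubmx A - ursubmx A *m iA22 *m dlsubmx A.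
Let red (g : 'cV[R]_(r + s)) := usubmx g - ursubmx A *m iA22 *m dsubmx g.

Lemma algebraic_part (g z : 'cV[R]_(r + s)) :
  dsubmx (A *m z + g) = 0 <->
  dsubmx z = - (invmx (drsubmx A) *m (dlsubmx A *m usubmx z + dsubmx g)).
Proof.
rewrite linearD/= dsub_mulmx; split => [H|->].
  apply/eqP; rewrite -subr_eq0 opprK addrC.
  rewrite -[X in _ + X](mulKmx A22) -mulmxDr addrAC H mulmx0; exact/eqP.
by rewrite mulmxN mulKVmx// opprD addrA subrK subrr.
Qed.

Let usub_red (g z : 'cV[R]_(r + s)) : dsubmx (A *m z + g) = 0 ->
  usubmx (A *m z + g) = At *m usubmx z + red g.
Proof.
move/algebraic_part => z2; rewrite linearD/= usub_mulmx z2 /At /red mulmxBl.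
by rewrite mulmxN mulmxA mulmxDr mulmxA opprD !addrA [LHS]addrAC.
Qed.

Let L1_red (g : R -> 'cV[R]_(r + s)) : L1 T g -> L1 T (fun t => red (g t)).
Proof.
move=> ig; apply: L1B; first exact: L1_usub.
by apply: L1_mulmxl => //; [exact: mbounded_cst|exact: L1_dsub].
Qed.

Let vintE (g z : R -> 'cV[R]_(r + s)) : L1 T g -> L1 T (fun t => usubmx (z t)) ->
  (forall t, t \in `[0, T] -> dsubmx (A *m z t + g t) = 0) ->
  forall t, t \in `[0, T] ->
  vint T b (fun t => usubmx (A *m z t + g t)) t =
  At *m vint T b (fun t => usubmx (z t)) t + vint T b (fun t => red (g t)) t.
Proof.
move=> ig iz H t tT.
have TT : T \in `[0, T] by rewrite in_itv/= lexx ltW.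
rewrite (@eq_vint _ T b _ _ _ (fun t => At *m usubmx (z t) + red (g t)) _ tT);
  last first.
  by move=> t' t'T; rewrite usub_red ?H.
have iA : L1 T (fun t => At *m usubmx (z t)).
  by apply: L1_mulmxl => //; exact: mbounded_cst.
have ir := L1_red ig.
rewrite /vint; case: b; rewrite !(mintD tT iA ir) ?(mintD TT iA ir) !(mint_mull T0)//.
by rewrite mulmxBr opprD addrACA.
Qed.

(** For a merely integrable g the component z_2 is no more regular than g. Its explicit formula is
    exported, at all real times, so that each application can read off the regularity it has: weakly
    differentiable for the state, square integrable for the adjoint. *)
Lemma dae_exists (g : R -> 'cV[R]_(r + s)) z0 : L1 T g ->
  exists z, [/\ mbounded T (fun t => usubmx (z t)), dae_sol b A g z0 z &
    forall t, dsubmx (z t) =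
      - (invmx (drsubmx A) *m (dlsubmx A *m usubmx (z t) + dsubmx (g t)))].
Proof.
move=> ig.
have bF : mbounded T (fun t => z0 + vint T b (fun t => red (g t)) t).
  by apply: mboundedD; [exact: mbounded_cst|exact/mbounded_vint/L1_red].
have [z1 bz1 z1E] := volterra_exists T0 b At bF.
pose z t := col_mx (z1 t) (- (iA22 *m (dlsubmx A *m z1 t + dsubmx (g t)))).
have z2E t : dsubmx (A *m z t + g t) = 0.
  by apply/algebraic_part; rewrite /z col_mxKu col_mxKd.
have zu : (fun t => usubmx (z t)) = z1 by apply/funext => t; rewrite /z col_mxKu.
exists z; split.
- by rewrite zu.
- move=> t tT; split => //; rewrite vintE//; last by rewrite zu; exact: mbounded_L1.
  by rewrite zu /z col_mxKu z1E// -addrA [At *m _ + _]addrC.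
- by move=> t; rewrite /z col_mxKu col_mxKd.
Qed.

Lemma vint_bound p q (F : R -> 'M[R]_(p, q)) M t : L1 T F -> 0 <= M ->
  (forall t, t \in `[0, T] -> `|F t| <= M) -> t \in `[0, T] ->
  `|vint T b F t| <= M * T.
Proof.
move=> iF M0 FM tT; have /andP[t0 tT'] : 0 <= t <= T by move: tT; rewrite in_itv.
have ic : sL1 T (fun=> M) by exact/sbounded_sL1/sbounded_cst.
rewrite /vint; case: b.
  apply: le_trans (le_mint_diff T0 iF ic t0 tT' (lexx _) _) _.
    by move=> x /[!in_itv]/= tx; apply: FM; rewrite in_itv/=; lra.
  by rewrite !sint_cst// ?(ltW T0)// gerBl mulr_ge0.
have := @le_mint_diff _ _ T0 _ _ _ _ _ _ iF ic (lexx _) t0 tT'.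
rewrite mint0 sint0 !subr0 sint_cst// => H; apply: le_trans (H _) _.
  by move=> x /[!in_itv]/= tx; apply: FM; rewrite in_itv/=; lra.
by rewrite ler_wpM2l.
Qed.

(** C is fixed before the source, the solution and the initial value. Here c1 bounds the reduced
    source, c2 bounds z_1 by the Volterra estimate, with 1 + c1 T because the source enters
    integrated, and c3 bounds z_2 through the algebraic rows. *)
Lemma dae_apriori : exists2 C, 0 <= C &
  forall (g z : R -> 'cV[R]_(r + s)) z0 M,
    mbounded T g -> mbounded T z -> dae_sol b A g z0 z ->
    `|z0| <= M -> (forall t, t \in `[0, T] -> `|g t| <= M) ->
    forall t, t \in `[0, T] -> `|z t| <= C * M.
Proof.
pose c1 := 1 + s%:R * `|ursubmx A *m iA22|.
pose c2 := 2 * expR ((2 * (r%:R * `|At|) + 1) * T) * (1 + c1 * T).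
pose c3 := s%:R * `|iA22| * (r%:R * `|dlsubmx A| * c2 + 1).
have T0' := ltW T0.
have c10 : 0 <= c1 by rewrite addr_ge0// mulr_ge0.
have c20 : 0 <= c2 by do ?[apply: mulr_ge0|apply: addr_ge0] => //; exact: expR_ge0.
have c30 : 0 <= c3 by do ?[apply: mulr_ge0|apply: addr_ge0].
exists (c2 + c3); first exact: addr_ge0.
move=> g z z0 M bg bz zsol z0M gM.
have M0 : 0 <= M by exact: le_trans z0M.
have ig := mbounded_L1 T0 bg.
have redM t : t \in `[0, T] -> `|red (g t)| <= c1 * M.
  move=> tT; apply: le_trans (ler_normB _ _) _; rewrite mulrDl mul1r.
  apply: lerD; first exact: le_trans (mx_norm_usub _) (gM _ tT).
  apply: le_trans (mx_norm_mul _ _) _; rewrite ler_wpM2l ?mulr_ge0//.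
  exact: le_trans (mx_norm_dsub _) (gM _ tT).
have z1M t : t \in `[0, T] -> `|usubmx (z t)| <= c2 * M.
  move=> tT; rewrite /c2 -mulrA.
  have bzu : mbounded T (fun t => usubmx (z t)) by exact: mbounded_usub.
  apply: (volterra_apriori T0 (b := b) (A := At)
    (F := fun t => z0 + vint T b (fun t => red (g t)) t) bzu) => //.
  - by rewrite mulr_ge0// addr_ge0// mulr_ge0.
  - move=> x xT; rewrite (proj1 (zsol x xT)) vintE//.
    + by rewrite -addrA [At *m _ + _]addrC.
    + exact: mbounded_L1.
    + by move=> y /zsol[].
  - move=> x xT; apply: le_trans (ler_normD _ _) _.
    rewrite mulrDl mul1r lerD// mulrAC; apply: vint_bound => //.
      exact: L1_red.
    by rewrite mulr_ge0.
move=> t tT; rewrite mulrDl; apply: mx_norm_split.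
  by apply: le_trans (z1M _ tT) _; rewrite lerDl mulr_ge0.
have /algebraic_part -> := proj2 (zsol t tT).
rewrite normrN; apply: (@le_trans _ _ (c3 * M)); last by rewrite lerDr mulr_ge0.
apply: le_trans (mx_norm_mul _ _) _; rewrite /c3 -[leRHS]mulrA ler_wpM2l ?mulr_ge0//.
apply: le_trans (ler_normD _ _) _; rewrite mulrDl mul1r; apply: lerD; last first.
  exact: le_trans (mx_norm_dsub _) (gM _ tT).
apply: le_trans (mx_norm_mul _ _) _; rewrite -[leRHS]mulrA ler_wpM2l ?mulr_ge0//.
exact: z1M.
Qed.

End DAE.

(** * Square integrable functions *)

Section SquareIntegrable.
Context (R : realType) (T : R).
Hypothesis T0 : 0 < T.
Local Notation mu := (@lebesgue_measure R).

Definition sL2 (f : R -> R) := measurable_fun `[0, T] f /\ sL1 T (fun t => f t ^+ 2).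

(** Links L^2 membership of the extension by zero, as in [L2], with integrability on [0, T], where
    the rest of the calculus takes place. *)
Lemma L2_sL2P (f : R -> R) :
  (((fun t : measurableTypeR R => f t) \_ `[0, T]%classic) \in Lfun mu 2%:E)
  <-> sL2 f.
Proof.
have mI : measurable (`[0, T]%classic : set (measurableTypeR R)) by exact:
  measurable_itv.
split=> [Lf|[mf If2]].
  split.
    move: (Lf); rewrite inE => /andP[/[!inE]/= + _].
    by move/(measurable_restrictT _ mI).
  apply/(integrable_mkcond _ mI); have := Lfun2_integrable_sqr Lf.
  congr (integrable _ _ _); apply/funext => t; rewrite /= /restrict /patch;
    case: ifPn => //= _.
  by rewrite expr0n.
rewrite inE; apply/andP; split; rewrite inE/=.
  exact/(measurable_restrictT _ mI).
rewrite /finite_norm unlock poweR_lty//.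
move: If2 => /integrableP[_]; rewrite [in X in X -> _]integral_mkcond;
  apply: le_lt_trans.
rewrite le_eqVlt; apply/orP; left; apply/eqP; apply: eq_integral => t _.
rewrite /= /restrict /patch; case: ifPn => /= _.
  by rewrite powR_mulrn// normrX.
by rewrite normr0 powR0.
Qed.

Lemma sbounded_sL2 f : sbounded T f -> sL2 f.
Proof.
by move=> bf; split; [case: bf|apply: sbounded_sL1 => //; exact: sboundedM].
Qed.

Lemma le_sL1 (f g : R -> R) : measurable_fun `[0, T] f ->
  (forall t, t \in `[0, T] -> `|f t| <= g t) -> sL1 T g -> sL1 T f.
Proof.
move=> mf fg; apply: le_integrable => //.
  exact/measurable_EFinP.
move=> t tT /=; rewrite lee_fin; apply: le_trans (fg t tT) (ler_norm _).
Qed.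

Lemma sL2D f g : sL2 f -> sL2 g -> sL2 (fun t => f t + g t).
Proof.
move=> [mf If] [mg Ig]; have mfg : measurable_fun `[0, T] (fun t => f t + g t).
  exact: measurable_funD.
split => //; apply: (le_sL1 (g := fun t => 2 * f t ^+ 2 + 2 * g t ^+ 2)).
- exact: measurable_funX.
- move=> t _; rewrite ger0_norm ?sqr_ge0//.
  have := sqr_ge0 (f t - g t); nra.
- by apply: sL1D; apply: sL1Ml => //; exact: sbounded_cst.
Qed.

Lemma sL2Ml f g : sbounded T f -> sL2 g -> sL2 (fun t => f t * g t).
Proof.
move=> bf [mg Ig]; split; first by apply: measurable_funM => //; case: bf.
apply: (eq_sL1 (f := fun t => (f t * f t) * g t ^+ 2)) => [t _|].
  by rewrite exprMn expr2.
by apply: sL1Ml => //; exact: sboundedM.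
Qed.

Lemma sL2_sum n (F : 'I_n -> R -> R) :
  (forall i, sL2 (F i)) -> sL2 (fun t => \sum_(i < n) F i t).
Proof.
elim: n F => [|n IH] F hF.
  by under eq_fun do rewrite big_ord0; exact/sbounded_sL2/sbounded_cst.
by under eq_fun do rewrite big_ord_recr/=; apply: sL2D => //; apply: IH.
Qed.

Lemma sL2_sL1 f : sL2 f -> sL1 T f.
Proof.
move=> [mf If]; apply: (le_sL1 (g := fun t => 1 + f t ^+ 2)) => //.
  move=> t _; rewrite ler_norml; have := sqr_ge0 (f t - 1); have := sqr_ge0 (f t + 1).
  by move=> *; apply/andP; split; nra.
by apply: sL1D => //; exact/sbounded_sL1/sbounded_cst.
Qed.

Lemma L2_L1 p q (F : R -> 'M[R]_(p, q)) : L2 T F -> L1 T F.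
Proof. by move=> LF i j; have /L2_sL2P/sL2_sL1 := LF i j. Qed.

Lemma mbounded_L2 p q (F : R -> 'M[R]_(p, q)) : mbounded T F -> L2 T F.
Proof. by move=> bF i j; apply/L2_sL2P/sbounded_sL2. Qed.

Lemma L2D p q (F G : R -> 'M[R]_(p, q)) : L2 T F -> L2 T G -> L2 T (fun t => F t + G t).
Proof.
move=> LF LG i j; apply/(L2_sL2P (fun t => (F t + G t) i j)).
under eq_fun do rewrite mxE.
by apply: sL2D; apply/L2_sL2P; [exact: LF|exact: LG].
Qed.

Lemma L2_mull p q k (A : 'M[R]_(p, q)) (F : R -> 'M[R]_(q, k)) :
  L2 T F -> L2 T (fun t => A *m F t).
Proof.
move=> LF i j; apply/(L2_sL2P (fun t => (A *m F t) i j)).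
under eq_fun do rewrite mxE.
by apply: sL2_sum => l; apply: sL2Ml; [exact: sbounded_cst|exact/L2_sL2P/LF].
Qed.

Lemma L2N p q (F : R -> 'M[R]_(p, q)) : L2 T F -> L2 T (fun t => - F t).
Proof.
move=> LF; have := L2_mull (- 1%:M) LF; congr (L2 T _).
by apply/funext => t; rewrite mulNmx mul1mx.
Qed.

Lemma L2_usub p1 p2 q (F : R -> 'M[R]_(p1 + p2, q)) :
  L2 T F -> L2 T (fun t => usubmx (F t)).
Proof.
move=> LF i j; apply/(L2_sL2P (fun t => usubmx (F t) i j)).
by under eq_fun do rewrite mxE; exact/L2_sL2P/LF.
Qed.

Lemma L2_dsub p1 p2 q (F : R -> 'M[R]_(p1 + p2, q)) :
  L2 T F -> L2 T (fun t => dsubmx (F t)).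
Proof.
move=> LF i j; apply/(L2_sL2P (fun t => dsubmx (F t) i j)).
by under eq_fun do rewrite mxE; exact/L2_sL2P/LF.
Qed.

Lemma L2_col p1 p2 q (F : R -> 'M[R]_(p1, q)) (G : R -> 'M[R]_(p2, q)) :
  L2 T F -> L2 T G -> L2 T (fun t => col_mx (F t) (G t)).
Proof.
move=> LF LG i j; apply/(L2_sL2P (fun t => col_mx (F t) (G t) i j)).
under eq_fun do rewrite mxE; case: splitP => k _; exact/L2_sL2P.
Qed.

End SquareIntegrable.

(** * The state equation *)

Section StateEquation.
Context (R : realType) (T : R).
Hypothesis T0 : 0 < T.
Local Notation mu := (@lebesgue_measure R).

(** A nonzero value persists near t within [0, T], also when t is an end point, hence on an open
    interval, which no null set contains. This turns the algebraic rows of the state equation from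
    almost everywhere into everywhere. *)
Lemma ae0_continuous (f : R -> R) : {within `[0, T], continuous f} ->
  (\forall t \ae mu, t \in `[0, T] -> f t = 0) ->
  forall t, t \in `[0, T] -> f t = 0.
Proof.
move=> cf [N [mN N0 fN]] t tT; apply/eqP; apply/negP => /negP ft0.
pose e := `|f t|.
have e0 : 0 < e by rewrite normr_gt0.
have /cvgrPdist_lt/(_ _ e0) : f @ within (fun x => x \in `[0, T]) (nbhs t) --> f t.
  by move/subspace_continuousP : cf; apply.
rewrite near_withinE => -[d /= d0 dH].
have sub x : ball t d x -> x \in `[0, T] -> N x.
  move=> xd xT; apply: fN => /= /(_ xT) fx0.
  by have := dH x xd xT; rewrite fx0 subr0 ltxx.
pose a := Num.max 0 (t - d / 2); pose b := Num.min T (t + d / 2).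
have ab : a < b.
  have /andP[t0 tT'] : 0 <= t <= T by move: tT; rewrite in_itv.
  have H (x y z : R) : 0 < x -> 0 < y -> 0 <= z -> z <= x ->
      Num.max 0 (z - y / 2) < Num.min x (z + y / 2).
    by move=> *; rewrite lt_min !gt_max; apply/andP; split; apply/andP; split; lra.
  exact: H.
have abN : `]a, b[ `<=` N.
  move=> x /=; rewrite in_itv/= /a /b gt_max lt_min.
  move=> /andP[/andP[x0 xt] /andP[xT tx]].
  apply: sub; last by rewrite in_itv/= !ltW.
  by rewrite /ball/= ltr_norml; lra.
have mab : measurable (`]a, b[%classic : set (measurableTypeR R)) by exact:
  measurable_itv.
have := le_measure mu (mem_set mab) (mem_set mN) abN.
rewrite [X in (_ <= X)%E]N0 -[X in (X <= _)%E]/(lebesgue_measure `]a, b[%classic).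
by rewrite lebesgue_measure_itv/= lte_fin ab -EFinB lee_fin subr_le0 leNgt ab.
Qed.

Lemma ae_eq_sint (f g : R -> R) t : sL1 T f -> sL1 T g -> t \in `[0, T] ->
  (\forall s \ae mu, s \in `[0, T] -> f s = g s) -> sint t f = sint t g.
Proof.
move=> If Ig tT fg; rewrite /sint /Rintegral; congr fine.
apply: ae_eq_integral.
- exact: measurable_itv.
- by have /integrableP[] := sL1_sub If tT.
- by have /integrableP[] := sL1_sub Ig tT.
- case: fg => N [mN N0 fgN]; exists N; split => // s Hs; apply: fgN => fgs.
  apply: Hs => st; congr EFin; apply: fgs.
  by move: st tT; rewrite /= !in_itv/=; lra.
Qed.

Definition mcont p q (F : R -> 'M[R]_(p, q)) :=
  forall i j, {within `[0, T], continuous (fun t => F t i j)}.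

Lemma mcont_mbounded p q (F : R -> 'M[R]_(p, q)) : mcont F -> mbounded T F.
Proof. by move=> cF i j; exact/continuous_sbounded. Qed.

Lemma mcontD p q (F G : R -> 'M[R]_(p, q)) : mcont F -> mcont G ->
  mcont (fun t => F t + G t).
Proof.
move=> cF cG i j.
have -> : (fun t => (F t + G t) i j) = (fun t => F t i j + G t i j).
  by apply/funext => t; rewrite mxE.
by move=> t; apply: continuousD; [exact: cF|exact: cG].
Qed.

Lemma mcont_mull p q k (A : 'M[R]_(p, q)) (F : R -> 'M[R]_(q, k)) : mcont F ->
  mcont (fun t => A *m F t).
Proof.
move=> cF i j.
have -> : (fun t => (A *m F t) i j) = \sum_l (fun t => A i l * F t l j).
  by apply/funext => t; rewrite mxE fct_sumE.
move=> t; elim/big_ind: _ => [|f g cf cg|l _].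
- exact: cst_continuous.
- exact: continuousD.
- by apply: continuousM; [exact: cst_continuous|exact: cF].
Qed.

Lemma H1_mcont p q (F dF : R -> 'M[R]_(p, q)) : H1 T F dF -> mcont F.
Proof.
move=> [LdF FE] i j.
have c : {within `[0, T], continuous (fun t => F 0 i j + sint t (fun s => dF s i j))}.
  have iF := sint_continuous T0 (L2_L1 T0 LdF i j).
  by move=> t; apply: (@continuousD _ _ (subspace `[0,
    T]%classic) (fun=> F 0 i j) (fun t => sint t (fun s => dF s i j)) t);
    [exact: cst_continuous|exact: iF].
apply: (@subspace_eq_continuous _ _ _ (fun t => F 0 i j + sint t (fun s => dF s i
  j))) => //.
move=> t /set_mem/= tT.
have E : F t i j = F 0 i j + sint t (fun s => dF s i j) by rewrite {1}FE// mxE mintE.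
exact/esym.
Qed.

(** The continuous extension of the derivative provided by [C1] serves as weak derivative. Its
    boundedness later makes the derivative of the state bounded. *)
Lemma C1_H1 m (u : R -> 'cV[R]_m) : C1 T u -> exists2 du, mbounded T du & H1 T u du.
Proof.
move=> [[du cu0 cuT] [df [cdf dfE]]].
have cdfij : mcont df.
  by move=> i j t; apply: (@continuous_comp (subspace `[0,
    T]%classic) _ _ df (fun M : 'cV[R]_m => M i j) t (cdf t)); exact: coord_continuous.
exists df; first exact: mcont_mbounded.
split; first exact/mbounded_L2/mcont_mbounded.
move=> t tT; apply/matrixP => i j; rewrite [RHS]mxE mintE.
have /andP[] : 0 <= t <= T by move: tT; rewrite in_itv.
rewrite le_eqVlt => /predU1P[<- _|t0 tT']; first by rewrite sint0 addr0.
have duT : derivable_oo_LRcontinuous (fun t => u t i j) 0 T.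
  split.
  - by move=> x xT; have /derivable_mxP := du x xT; exact.
  - by have := cvg_comp _ _ cu0 (@coord_continuous _ _ _ i j _).
  - by have := cvg_comp _ _ cuT (@coord_continuous _ _ _ i j _).
have dut : derivable_oo_LRcontinuous (fun t => u t i j) 0 t.
  apply: derivable_oo_continuousW duT => //.
  by apply: subset_itvl; rewrite bnd_simp.
rewrite /sint /Rintegral (@continuous_FTC2 _ _ (fun t => u t i j) _ _ t0)//=.
- by rewrite addrC subrK.
- apply: continuous_subspaceW (cdfij i j).
  by apply: subset_itvl; rewrite bnd_simp.
- move=> x xt; have xT : x \in `]0, T[.
    by move: xt; rewrite !in_itv/= => /andP[-> /lt_le_trans]; exact.
  by rewrite -dfE// derive1E derive1E derive_mx ?mxE//; exact: du.
Qed.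

End StateEquation.

Section State.
Context (R : realType) (T : R).
Hypothesis T0 : 0 < T.
Context (m r s : nat) (u : R -> 'cV[R]_m).
Hypothesis uC1 : C1 T u.

Lemma usub_matE (z : 'cV[R]_(r + s)) : usubmx (matE R r s *m z) = usubmx z.
Proof.
by rewrite -{1}[z]vsubmxK /matE mul_block_col col_mxKu mul1mx mul0mx addr0.
Qed.

Lemma dsub_matE (z : 'cV[R]_(r + s)) : dsubmx (matE R r s *m z) = 0.
Proof.
by rewrite -{1}[z]vsubmxK /matE mul_block_col col_mxKd !mul0mx addr0.
Qed.

Lemma C1_mcont : mcont T u.
Proof. by have [du _ /(H1_mcont T0)] := C1_H1 T0 uC1. Qed.

Let Bu (v : W R m r s) t := vB v *m u t.

Lemma mbounded_Bu (v : W R m r s) : mbounded T (Bu v).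
Proof. by apply/mcont_mbounded/mcont_mull/C1_mcont. Qed.

(** [H1] demands a weak derivative of x_2 too, about which E x' says nothing. It is obtained by
    differentiating the algebraic rows ([d2] below), and there the derivative of u enters. *)
Lemma state_exists (v : W R m r s) : index1 v -> exists x, is_state T u v x.
Proof.
move=> idx; have [du bdu [_ uE]] := C1_H1 T0 uC1.
have iBu := mbounded_L1 T0 (mbounded_Bu v).
have [z [bz zsol z2E]] := dae_exists T0 false idx (vx v) iBu.
set A := matA v in zsol z2E *.
have bz2 : mbounded T (fun t => dsubmx (z t)).
  under eq_fun do rewrite z2E; apply: mboundedN; apply: mbounded_mulmx;
    first exact: mbounded_cst.
  apply: mboundedD; last exact/mbounded_dsub/mbounded_Bu.
  by apply: mbounded_mulmx => //; exact: mbounded_cst.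
have bzz : mbounded T z.
  apply: (eq_mbounded _ (mbounded_col bz bz2)) => t _; exact: vsubmxK.
pose f t := usubmx (A *m z t + Bu v t).
have bf : mbounded T f.
  apply: mbounded_usub; apply: mboundedD; last exact: mbounded_Bu.
  by apply: mbounded_mulmx => //; exact: mbounded_cst.
pose d2 t := - (invmx (drsubmx A) *m (dlsubmx A *m f t + dsubmx (vB v *m du t))).
have bd2 : mbounded T d2.
  apply: mboundedN; apply: mbounded_mulmx; first exact: mbounded_cst.
  apply: mboundedD; first by apply: mbounded_mulmx => //; exact: mbounded_cst.
  by apply: mbounded_dsub; apply: mbounded_mulmx => //; exact: mbounded_cst.
have in0 : 0 \in `[0, T] by rewrite in_itv/= lexx ltW.
have z0 : usubmx (z 0) = vx v by rewrite (proj1 (zsol 0 in0)) /vint mint0 addr0.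
exists z; exists (fun t => col_mx (f t) (d2 t)); split => //.
- split; first exact/mbounded_L2/mbounded_col.
  move=> t tT; rewrite -[LHS]vsubmxK -[z 0]vsubmxK -[X in _ + X]vsubmxK add_col_mx.
  have -> : usubmx (mint t (fun t => col_mx (f t) (d2 t))) = mint t f.
    by rewrite -mint_usub; apply: eq_mint => x _; rewrite col_mxKu.
  have -> : dsubmx (mint t (fun t => col_mx (f t) (d2 t))) = mint t d2.
    by rewrite -mint_dsub; apply: eq_mint => x _; rewrite col_mxKd.
  have z1t : usubmx (z t) = usubmx (z 0) + mint t f.
    by rewrite z0 (proj1 (zsol t tT)).
  congr col_mx => //; rewrite !z2E z1t.
  have -> : mint t d2 = - (invmx (drsubmx A) *m
      (dlsubmx A *m mint t f + dsubmx (vB v *m mint t du))).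
    have idu := mbounded_L1 T0 bdu; have iff := mbounded_L1 T0 bf.
    have iBdu : L1 T (fun t => vB v *m du t).
      by apply: L1_mulmxl => //; exact: mbounded_cst.
    have iAf : L1 T (fun t => dlsubmx A *m f t).
      by apply: L1_mulmxl => //; exact: mbounded_cst.
    have idB := L1_dsub iBdu.
    rewrite -(mint_mull T0 tT _ idu) -mint_dsub -(mint_mull T0 tT _ iff).
    rewrite -(mintD tT iAf idB) -mulNmx -(mint_mull T0 tT _ (L1D iAf idB)).
    by apply: eq_mint => x _; rewrite /d2 mulNmx.
  rewrite -opprD -mulmxDr; congr (- (_ *m _)).
  by rewrite /Bu (uE t tT) !mulmxDr linearD/= addrACA.
- exists set0; split => // t nP; apply: nP => tT.
  rewrite -[LHS]vsubmxK -[RHS]vsubmxK usub_matE dsub_matE col_mxKu.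
  by rewrite (proj2 (zsol t tT)).
Qed.

(** The upper rows are integrated, which absorbs the null set. In the lower rows E x' vanishes, and
    A x + B u is continuous, so vanishing almost everywhere means vanishing everywhere. *)
Lemma is_state_dae (v : W R m r s) x : is_state T u v x ->
  mbounded T x /\ dae_sol T false (matA v) (Bu v) (vx v) x.
Proof.
move=> [dx [xH1 eq0 x0]]; have cx := H1_mcont T0 xH1.
case: xH1 => Ldx xE; split; first exact: mcont_mbounded.
have cg : mcont T (fun t => matA v *m x t + Bu v t).
  by apply: mcontD; apply: mcont_mull => //; exact: C1_mcont.
have ig := mbounded_L1 T0 (mcont_mbounded cg).
have idx := L2_L1 T0 Ldx.
move=> t tT; split.
  rewrite {1}(xE t tT) linearD/= x0; congr (_ + _); rewrite /vint.
  apply/matrixP => i j; rewrite mxE !mintE; apply: (@ae_eq_sint _ T) => //.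
    exact: (L1_usub ig i j).
  case: eq0 => N [mN N0 HN]; exists N; split => // y Hy; apply: HN => Hy'.
  apply: Hy => yT; have := congr1 (fun z => usubmx z i j) (Hy' yT).
  by rewrite usub_matE mxE.
apply/matrixP => i j; rewrite [RHS]mxE.
apply: (ae0_continuous T0 (f := fun t => dsubmx (matA v *m x t + Bu v t) i j)) => //.
  have -> : (fun t => dsubmx (matA v *m x t + Bu v t) i j) =
      (fun t => (matA v *m x t + Bu v t) (rshift r i) j).
    by apply/funext => y; rewrite mxE.
  exact: cg.
case: eq0 => N [mN N0 HN]; exists N; split => // y Hy; apply: HN => Hy'.
apply: Hy => yT; have := congr1 (fun z => dsubmx z i j) (Hy' yT).
by rewrite dsub_matE mxE.
Qed.

Lemma stateP (v : W R m r s) : index1 v -> is_state T u v (state T u v).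
Proof. by move=> /state_exists; exact: getPex. Qed.

End State.

(** * Frobenius inner product *)

Section Frobenius.
Context (R : realType).

Lemma frobC p q (A B : 'M[R]_(p, q)) : frob A B = frob B A.
Proof. by rewrite /frob -mxtrace_tr trmx_mul trmxK. Qed.

Lemma frobDl p q (A B C : 'M[R]_(p, q)) : frob (A + B) C = frob A C + frob B C.
Proof. by rewrite /frob linearD/= mulmxDl linearD. Qed.

Lemma frobDr p q (A B C : 'M[R]_(p, q)) : frob C (A + B) = frob C A + frob C B.
Proof. by rewrite /frob mulmxDr linearD. Qed.

Lemma frobNl p q (A C : 'M[R]_(p, q)) : frob (- A) C = - frob A C.
Proof. by rewrite /frob linearN/= mulNmx linearN. Qed.

Lemma frobNr p q (A C : 'M[R]_(p, q)) : frob C (- A) = - frob C A.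
Proof. by rewrite /frob mulmxN linearN. Qed.

Lemma frobBl p q (A B C : 'M[R]_(p, q)) : frob (A - B) C = frob A C - frob B C.
Proof. by rewrite frobDl frobNl. Qed.

Lemma frobBr p q (A B C : 'M[R]_(p, q)) : frob C (A - B) = frob C A - frob C B.
Proof. by rewrite frobDr frobNr. Qed.

Lemma frobZl p q c (A C : 'M[R]_(p, q)) : frob (c *: A) C = c * frob A C.
Proof. by rewrite /frob linearZ/= -scalemxAl linearZ. Qed.

Lemma frobZr p q c (A C : 'M[R]_(p, q)) : frob C (c *: A) = c * frob C A.
Proof. by rewrite /frob -scalemxAr linearZ. Qed.

Lemma frob_tr p q (A B : 'M[R]_(p, q)) : frob A^T B^T = frob A B.
Proof. by rewrite /frob trmxK mxtrace_mulC -mxtrace_tr trmx_mul trmxK. Qed.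

Lemma frob_mull p q k (A : 'M[R]_(p, q)) (B : 'M[R]_(p, k)) (C : 'M[R]_(q, k)) :
  frob B (A *m C) = frob (A^T *m B) C.
Proof. by rewrite /frob trmx_mul trmxK mulmxA. Qed.

Lemma frob_mulr p q k (A : 'M[R]_(q, k)) (B : 'M[R]_(p, k)) (C : 'M[R]_(p, q)) :
  frob B (C *m A) = frob (B *m A^T) C.
Proof. by rewrite /frob trmx_mul trmxK mulmxA mxtrace_mulC mulmxA. Qed.

Lemma frob_split p1 p2 q (A B : 'M[R]_(p1 + p2, q)) :
  frob A B = frob (usubmx A) (usubmx B) + frob (dsubmx A) (dsubmx B).
Proof.
by rewrite -{1}[A]vsubmxK -{1}[B]vsubmxK /frob tr_col_mx mul_row_col linearD.
Qed.

Lemma frob0r p q (A : 'M[R]_(p, q)) : frob A 0 = 0.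
Proof. by rewrite /frob mulmx0 linear0. Qed.

Lemma frob0l p q (A : 'M[R]_(p, q)) : frob 0 A = 0.
Proof. by rewrite frobC frob0r. Qed.

Lemma frob_ge0 p q (A : 'M[R]_(p, q)) : 0 <= frob A A.
Proof.
by rewrite frobE; apply: sumr_ge0 => i _; apply: sumr_ge0 => j _;
  rewrite -expr2 sqr_ge0.
Qed.

Lemma frob_eq0 p q (A : 'M[R]_(p, q)) : frob A A = 0 -> A = 0.
Proof.
rewrite frobE => /eqP; rewrite psumr_eq0; last first.
  by move=> i _; apply: sumr_ge0 => j _; rewrite -expr2 sqr_ge0.
move=> /allP H; apply/matrixP => i j; rewrite mxE.
have /implyP/(_ isT) := H i (mem_index_enum _).
rewrite psumr_eq0; last by move=> l _; rewrite -expr2 sqr_ge0.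
by move=> /allP/(_ j (mem_index_enum _))/implyP/(_ isT); rewrite mulf_eq0 orbb => /eqP.
Qed.

(** The pairing of a with C b, read as a linear form in C, is represented by the outer product; this
    is how outer products enter the gradient. *)
Lemma frob_outer p q (a : 'cV[R]_p) (b : 'cV[R]_q) (C : 'M[R]_(p, q)) :
  frob (outer a b) C = frob a (C *m b).
Proof. by rewrite frob_mulr. Qed.

Lemma fnorm_sqr p q (A : 'M[R]_(p, q)) : fnorm A ^+ 2 = frob A A.
Proof. by rewrite /fnorm sqr_sqrtr// frob_ge0. Qed.

End Frobenius.

(** * The adjoint equation *)

Section Adjoint.
Context (R : realType) (T : R).
Hypothesis T0 : 0 < T.

Let TT : T \in `[0, T]. Proof. by rewrite in_itv/= lexx ltW. Qed.
Let in0 : 0 \in `[0, T]. Proof. by rewrite in_itv/= lexx ltW. Qed.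

Lemma sL1_frob p q (F G : R -> 'M[R]_(p, q)) : L1 T F -> mbounded T G ->
  sL1 T (fun t => frob (F t) (G t)).
Proof.
move=> iF bG; under eq_fun do rewrite frobE.
by apply: sL1_sum => // i; apply: sL1_sum => // j; exact: sL1M.
Qed.

(** The boundary term at T is absorbed by taking the primitive of f over [t, T], the form in which
    p_1 is given by its terminal value problem. *)
Lemma frob_by_parts p q (f g : R -> 'M[R]_(p, q)) : L1 T f -> mbounded T g ->
  sint T (fun t => frob (f t) (mint t g)) =
  sint T (fun t => frob (mint T f - mint t f) (g t)).
Proof.
move=> iF bG; have iG := mbounded_L1 T0 bG.
have bmG := mbounded_mint T0 iG; have bmF := mbounded_mint T0 iF.
under eq_sint do rewrite frobE; under [RHS]eq_sint do rewrite frobE.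
have i1 i j : sL1 T (fun t => f t i j * (mint t g) i j) by exact: sL1M.
have i2 i j : sL1 T (fun t => (mint T f - mint t f) i j * g t i j).
  apply: sL1M => //; apply: (L1B _ _ i j); first exact/mbounded_L1/mbounded_cst.
  exact: mbounded_L1.
rewrite !(sint_sum T0 TT); try by move=> i; exact: sL1_sum.
apply: eq_bigr => i _; rewrite !(sint_sum T0 TT)//; apply: eq_bigr => j _.
have := sint_by_parts T0 (iF i j) (bG i j).
have -> : sint T (fun t => f t i j * mint t g i j) =
    sint T (fun t => f t i j * sint t (fun s => g s i j)).
  by apply: eq_sint => t _; rewrite mintE.
have -> : sint T (fun t => (mint T f - mint t f) i j * g t i j) =
   sint T (fun t => sint T (fun s => f s i j) * g t i j - g t i j * sint t (fun s =>
     f s i j)).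
  by apply: eq_sint => t _; rewrite mxE [X in _ + X]mxE !mintE; ring.
rewrite (sintB TT).
- by rewrite (sintZl _ TT)// => <-; rewrite addrK.
- by apply: sL1Ml => //; exact: sbounded_cst.
- by apply/(sbounded_sL1 T0)/sboundedM => //; apply: sbounded_sint.
Qed.

Context (r s : nat).
Implicit Types (A : 'M[R]_(r + s)).

(** Put q = A^T p + G and e = A d + g. The algebraic rows say q_2 = 0 and e_2 = 0, so the pairing of
    q with d involves only d_1 = h0 + int e_1, and integration by parts moves the integral onto q_1,
    producing p_1. The terms with A then cancel, since A^T p paired with d is p paired with A d. *)
Lemma duality A (G g p d : R -> 'cV[R]_(r + s)) h0 :
  L1 T G -> mbounded T g -> L1 T p -> mbounded T d ->
  dae_sol T true A^T G 0 p -> dae_sol T false A g h0 d ->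
  sint T (fun t => frob (G t) (d t)) =
  frob (usubmx (p 0)) h0 + sint T (fun t => frob (p t) (g t)).
Proof.
move=> iG bg ip bd psol dsol.
pose q t := A^T *m p t + G t; pose e t := A *m d t + g t.
have iq : L1 T q by apply: L1D => //; apply: L1_mulmxl => //; exact: mbounded_cst.
have be : mbounded T e by apply: mboundedD => //; apply: mbounded_mulmx => //;
  exact: mbounded_cst.
have bAd : mbounded T (fun t => A *m d t) by apply: mbounded_mulmx => //;
  exact: mbounded_cst.
have iqu := L1_usub iq; have beu := mbounded_usub be.
have E1 : sint T (fun t => frob (q t) (d t)) =
    frob (usubmx (p 0)) h0 + sint T (fun t => frob (p t) (e t)).
  transitivity (sint T (fun t => frob (usubmx (q t)) h0 +
      frob (usubmx (q t)) (mint t (fun t => usubmx (e t))))).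
    apply: eq_sint => t tT; rewrite frob_split (proj2 (psol t tT)) frob0l addr0.
    by rewrite (proj1 (dsol t tT)) frobDr.
  rewrite (sintD TT); last 2 first.
  - by apply: sL1_frob => //; exact: mbounded_cst.
  - by apply: sL1_frob => //; apply: mbounded_mint => //; exact: mbounded_L1.
  rewrite -(mint_frob T0 TT _ iqu) frob_by_parts//; congr (frob _ _ + _).
    by rewrite (proj1 (psol 0 in0)) /vint mint0 subr0 add0r.
  apply: eq_sint => t tT; rewrite frob_split (proj2 (dsol t tT)) frob0r addr0.
  by rewrite (proj1 (psol t tT)) add0r.
have iqd : sint T (fun t => frob (q t) (d t)) =
    sint T (fun t => frob (p t) (A *m d t)) + sint T (fun t => frob (G t) (d t)).
  rewrite -(sintD TT); try exact: sL1_frob.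
  by apply: eq_sint => t _; rewrite frobDl frob_mull.
have ipe : sint T (fun t => frob (p t) (e t)) =
    sint T (fun t => frob (p t) (A *m d t)) + sint T (fun t => frob (p t) (g t)).
  rewrite -(sintD TT); try exact: sL1_frob.
  by apply: eq_sint => t _; rewrite frobDr.
by move: E1; rewrite iqd ipe; lra.
Qed.

(** The adjoint matrix K^T - K - L L^T is the transpose of [matA v], so its algebraic block is
    invertible along with that of the state equation. The conclusions beyond [is_adjoint] are the
    integral form and the integrability that [duality] asks for. *)
Lemma adjoint_exists m (v : W R m r s) (y yd : R -> 'cV[R]_m) :
  index1 v -> L2 T (fun t => y t - yd t) ->
  exists p, [/\ is_adjoint T yd v y p, L1 T p, mbounded T (fun t => usubmx (p t)) &
    dae_sol T true (matA v)^T (fun t => vB v *m (y t - yd t)) 0 p].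
Proof.
move=> idx Le.
pose G t := vB v *m (y t - yd t).
have LG : L2 T G by exact: L2_mull.
have iG := L2_L1 T0 LG.
have A22 : drsubmx (matA v)^T \in unitmx by rewrite -trmx_drsub unitmx_tr.
have [p [bp psol p2E]] := dae_exists T0 true A22 0 iG.
have Lp2 : L2 T (fun t => dsubmx (p t)).
  under eq_fun do rewrite p2E.
  apply: L2N => //; apply: L2_mull => //; apply: L2D => //.
    by apply: L2_mull => //; exact: mbounded_L2.
  exact: L2_dsub.
have Lp : L2 T p.
  have := L2_col (mbounded_L2 T0 bp) Lp2; congr (L2 T _).
  by apply/funext => t; rewrite vsubmxK.
pose q t := (matA v)^T *m p t + G t.
have Lq : L2 T q by apply: L2D => //; exact: L2_mull.
have iqu := L1_usub (L2_L1 T0 Lq).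
have AT : (matA v)^T = (vK v)^T - vK v - vL v *m (vL v)^T.
  by rewrite /matA !linearB/= trmxK trmx_mul trmxK.
exists p; split => //; last exact: L2_L1.
exists (fun t => - q t); split => //.
- split.
    under eq_fun do rewrite linearN/=.
    by apply: L2N => //; exact: L2_usub.
  move=> t tT; rewrite (proj1 (psol t tT)) (proj1 (psol 0 in0)) /vint mint0 subr0
    !add0r.
  congr (_ + _); apply/matrixP => i j;
    rewrite [LHS]mxE !mintE -mulN1r -(sintZl _ tT (iqu i j)).
  by apply: eq_sint => x _; rewrite mulN1r !mxE.
- exists set0; split => // t nP; apply: nP => tT.
  rewrite mulmxN opprK -AT -/(G t) -/(q t).
  rewrite -[LHS]vsubmxK -[RHS]vsubmxK usub_matE dsub_matE.
  by rewrite (proj2 (psol t tT)).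
- by rewrite (proj1 (psol T TT)) /vint subrr addr0.
Qed.

End Adjoint.

(** * Expansion of the tracking cost *)

Section WNorm.
Context (R : realType) (m r s : nat).
Implicit Types w h : W R m r s.

Lemma vKD w h : vK (w + h) = vK w + vK h. Proof. by []. Qed.

Lemma vLD w h : vL (w + h) = vL w + vL h. Proof. by []. Qed.

Lemma vBD w h : vB (w + h) = vB w + vB h. Proof. by []. Qed.

Lemma vxD w h : vx (w + h) = vx w + vx h. Proof. by []. Qed.

Lemma vK_le h : `|vK h| <= `|h|.
Proof. by rewrite /vK !prod_normE !le_max lexx. Qed.

Lemma vL_le h : `|vL h| <= `|h|.
Proof. by rewrite /vL !prod_normE !le_max lexx !orbT. Qed.

Lemma vB_le h : `|vB h| <= `|h|.
Proof. by rewrite /vB !prod_normE !le_max lexx !orbT. Qed.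

Lemma vx_le h : `|vx h| <= `|h|.
Proof. by rewrite /vx !prod_normE !le_max lexx !orbT. Qed.

End WNorm.

(** A row vector w in the kernel satisfies w = - w D A^-1, which under the smallness condition
    forces |w| < |w| unless w = 0. The two factors n stem from the two matrix products. *)
Lemma unitmx_perturb (R : realType) n (A D : 'M[R]_n) : A \in unitmx ->
  n%:R * (n%:R * `|invmx A|) * `|D| < 1 -> A + D \in unitmx.
Proof.
move=> uA D1; rewrite -row_free_unit -kermx_eq0; apply/rowV0P => w /sub_kermxP.
rewrite mulmxDr => /eqP; rewrite addr_eq0 => /eqP wA.
have wE : w = - (w *m D *m invmx A) by rewrite -mulNmx -wA mulmxK.
apply/eqP; rewrite -normr_le0 leNgt; apply/negP => w0.
suff : `|w| < `|w| by rewrite ltxx.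
rewrite {1}wE normrN; apply: le_lt_trans (mx_norm_mul _ _) _.
apply: (@le_lt_trans _ _ (n%:R * (n%:R * `|w| * `|D|) * `|invmx A|)).
  by rewrite ler_wpM2r// ler_wpM2l// mx_norm_mul.
rewrite [ltLHS](_ : _ = `|w| * (n%:R * (n%:R * `|invmx A|) * `|D|)); last by ring.
by rewrite -[ltRHS]mulr1 ltr_pM2l.
Qed.

Section Expansion.
Context (R : realType) (T : R).
Hypothesis T0 : 0 < T.
Context (m r s : nat) (u yd : R -> 'cV[R]_m) (v : W R m r s).
Hypothesis uC1 : C1 T u.
Hypothesis Lyd : L2 T yd.
Hypothesis idx : index1 v.

Let n := (r + s)%N.
Let TT : T \in `[0, T]. Proof. by rewrite in_itv/= lexx ltW. Qed.

Definition J1 (w : W R m r s) : R :=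
  2^-1 * sint T (fun t => fnorm ((vB w)^T *m state T u w t - yd t) ^+ 2).

(** C is the integral of the sum of the |F_ij|. It takes the place of a sup bound for p and the
    misfit, which may be unbounded. *)
Lemma frob_sint_bound p q (F : R -> 'M[R]_(p, q)) : L1 T F ->
  exists2 C, 0 <= C & forall G M, mbounded T G -> 0 <= M ->
    (forall t, t \in `[0, T] -> `|G t| <= M) ->
    `|sint T (fun t => frob (F t) (G t))| <= C * M.
Proof.
move=> iF; pose f t := \sum_i \sum_j `|F t i j|.
have If : sL1 T f by apply: sL1_sum => // i; apply: sL1_sum => // j; exact: sL1_norm.
have f0 t : 0 <= f t by apply: sumr_ge0 => i _; exact: sumr_ge0.
exists (sint T f); first by apply: Rintegral_ge0 => t _.
move=> G M bG M0 GM; rewrite mulrC -(sintZl _ TT If).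
apply: (@le_sint _ T) => //; first exact: sL1_frob.
  by apply: sL1Ml => //; exact: sbounded_cst.
move=> t tT; rewrite frobE mulr_sumr; apply: le_trans (ler_norm_sum _ _ _) _.
apply: ler_sum => i _; rewrite mulr_sumr; apply: le_trans (ler_norm_sum _ _ _) _.
apply: ler_sum => j _; rewrite normrM mulrC ler_wpM2r//.
exact: le_trans (mx_norm_entry _ _ _) (GM _ tT).
Qed.

Let A := matA v.
Let L := vL v.
Let B := vB v.

Definition dmatA (h : W R m r s) : 'M[R]_(r + s) :=
  vK h - (vK h)^T - (vL h *m L^T + L *m (vL h)^T).

Lemma matA_expand h : matA (v + h) - A = dmatA h - vL h *m (vL h)^T.
Proof.
have tD (a b : 'M[R]_(r + s)) : (a + b)^T = a^T + b^T by rewrite linearD.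
rewrite /A /matA /dmatA /L vKD vLD !tD mulmxDl !mulmxDr.
set c := vL v *m _; set c1 := vL v *m _; set c2 := vL h *m _; set c3 := vL h *m _.
clearbody c c1 c2 c3; move: (vK v) (vK h) => a b.
by apply/matrixP => i j; rewrite !mxE; ring.
Qed.

(** The 2 accounts for K - K^T, each n |L| for one mixed product of L with its increment, and the
    last n for the quadratic term, which is linear in |h| once |h| <= 1. *)
Let cA : R := 2 + n%:R * `|L| + n%:R * `|L| + n%:R.

Lemma matA_Lipschitz h : `|h| <= 1 -> `|matA (v + h) - A| <= cA * `|h|.
Proof.
move=> h1; rewrite matA_expand /dmatA /cA.
have hK := vK_le h; have hL := vL_le h; set z := `|h| in h1 hK hL *.
have z0 : 0 <= z by exact: normr_ge0.
have n0 : (0 : R) <= n%:R by [].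
have e1 : `|vL h *m L^T| <= n%:R * `|L| * z.
  apply: le_trans (mx_norm_mul _ _) _; rewrite mx_norm_tr mulrAC.
  by rewrite ler_wpM2l// mulr_ge0.
have e2 : `|L *m (vL h)^T| <= n%:R * `|L| * z.
  apply: le_trans (mx_norm_mul _ _) _; rewrite mx_norm_tr.
  by rewrite ler_wpM2l// mulr_ge0.
have e3 : `|vL h *m (vL h)^T| <= n%:R * z.
  apply: le_trans (mx_norm_mul _ _) _; rewrite mx_norm_tr -mulrA ler_wpM2l//.
  by rewrite -[leRHS]mulr1 ler_pM// (le_trans hL).
apply: le_trans (ler_normB _ _) _; rewrite mulrDl; apply: lerD => //.
apply: le_trans (ler_normB _ _) _; rewrite -addrA mulrDl; apply: lerD.
  by apply: le_trans (ler_normB _ _) _; rewrite mx_norm_tr; lra.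
by apply: le_trans (ler_normD _ _) _; rewrite mulrDl; exact: lerD.
Qed.

Lemma index1_near : exists2 rho, 0 < rho & forall h : W R m r s, `|h| <= rho ->
  index1 (v + h).
Proof.
have cA0 : 0 <= cA by rewrite !addr_ge0// mulr_ge0.
pose c := s%:R * (s%:R * `|invmx (drsubmx A)|) * cA + 1.
have c0 : 0 < c by rewrite ltr_wpDl// !mulr_ge0.
(* The bound 1 makes the Lipschitz estimate of [matA] available; the other gives c |h| <= 1/2, below
   the threshold of [unitmx_perturb]. *)
exists (Num.min 1 (c^-1 / 2)); first by rewrite lt_min ltr01 divr_gt0// invr_gt0.
move=> h; rewrite le_min => /andP[h1 hc]; rewrite /index1.
have -> : drsubmx (matA (v + h)) = drsubmx A + drsubmx (matA (v + h) - A).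
  have E (a b : 'M[R]_(r + s)) : drsubmx (a + (b - a)) = drsubmx a + drsubmx (b - a).
    by apply/matrixP => i j; rewrite !mxE.
  by rewrite -E subrKC.
apply: unitmx_perturb => //.
have dr : `|drsubmx (matA (v + h) - A)| <= cA * `|h|.
  apply: le_trans (matA_Lipschitz h1).
  by apply: mx_norm_le => // i j; rewrite mxE mxE mx_norm_entry.
apply: (@le_lt_trans _ _ (c * `|h|)).
  apply: le_trans (ler_wpM2l _ dr) _; first by rewrite !mulr_ge0.
  by rewrite [leLHS]mulrA ler_wpM2r// /c lerDl.
apply: (@le_lt_trans _ _ (c * (c^-1 / 2))); first by rewrite ler_wpM2l// ltW.
by rewrite mulrA divff ?gt_eqF//; lra.
Qed.

End Expansion.

(** * Lipschitz dependence of the state on the parameters *)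

Section Perturbation.
Context (R : realType) (T : R).
Hypothesis T0 : 0 < T.
Context (m r s : nat) (u : R -> 'cV[R]_m) (v : W R m r s).
Hypothesis uC1 : C1 T u.
Hypothesis idx : index1 v.

Let n := (r + s)%N.
Let TT : T \in `[0, T]. Proof. by rewrite in_itv/= lexx ltW. Qed.
Let A := matA v.
Let x := state T u v.

Let bu : mbounded T u. Proof. exact/mcont_mbounded/C1_mcont. Qed.
Let bx : mbounded T x. Proof. by have [] :=
  is_state_dae T0 uC1 (stateP T0 uC1 idx). Qed.

Lemma state_diff_dae h : index1 (v + h) ->
  dae_sol T false A
    (fun t => (matA (v + h) - A) *m state T u (v + h) t + vB h *m u t) (vx h)
    (fun t => state T u (v + h) t - x t).
Proof.
move=> idx'.
have [_ sol] := is_state_dae T0 uC1 (stateP T0 uC1 idx).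
have [bx' sol'] := is_state_dae T0 uC1 (stateP T0 uC1 idx').
rewrite -/x in sol; set x' := state T u (v + h) in bx' sol' *.
move=> t tT.
pose f y := A *m x y + vB v *m u y.
pose f' y := matA (v + h) *m x' y + vB (v + h) *m u y.
have bM (w : W R m r s) z : mbounded T z ->
  mbounded T (fun y => matA w *m z y + vB w *m u y).
  move=> bz; apply: mboundedD; apply: mbounded_mulmx => //; exact: mbounded_cst.
have E y : A *m (x' y - x y) + ((matA (v + h) - A) *m x' y + vB h *m u y) = f' y - f y.
  have -> : f' y = matA (v + h) *m x' y + (vB v *m u y + vB h *m u y).
    by rewrite -mulmxDl.
  rewrite /f (mulmxBr A) (mulmxBl (matA (v + h)) A).
  set a := A *m x' y; set b := A *m x y; set c := matA _ *m _.
  set d := vB v *m _; set k := vB h *m _.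
  clearbody a b c d k.
  by apply/matrixP => i j; rewrite !mxE; ring.
split; last by rewrite E linearB/= (proj2 (sol' t tT)) (proj2 (sol t tT)) subrr.
rewrite linearB/= (proj1 (sol' t tT)) (proj1 (sol t tT)) /vint.
rewrite vxD.
under [in RHS]eq_mint do rewrite E linearB/=.
rewrite (mintB tT); first by rewrite opprD addrACA [vx v + _]addrC addrK.
- exact/L1_usub/(mbounded_L1 T0)/bM.
- exact/L1_usub/(mbounded_L1 T0)/bM.
Qed.

Lemma state_Lipschitz : exists2 rho, 0 < rho & exists2 C, 0 <= C &
  forall h, `|h| <= rho -> index1 (v + h) /\
    forall t, t \in `[0, T] -> `|state T u (v + h) t - x t| <= C * `|h|.
Proof.
have [rho1 rho10 idx1] := index1_near idx.
have [C0 C00 apriori] := dae_apriori T0 false idx.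
have [X X0 xX] := mbounded_bound bx; have [U U0 uU] := mbounded_bound bu.
pose cA : R := 2 + n%:R * `|vL v| + n%:R * `|vL v| + n%:R.
have cA0 : 0 <= cA by rewrite !addr_ge0// mulr_ge0.
(* [kap] bounds, per unit of |h|, the source with x in place of x' and, through the summand 1, the
   initial value. [th] dominates the coefficient of the feedback from x' - x, and the radius makes
   that feedback at most one half. *)
pose kap := n%:R * cA * X + m%:R * U + 1.
have kap0 : 0 <= kap by rewrite !addr_ge0// !mulr_ge0.
pose th := C0 * (n%:R * cA) + 1.
have th0 : 0 < th by rewrite ltr_wpDl// !mulr_ge0.
exists (Num.min rho1 (Num.min 1 (th^-1 / 2))).
  by rewrite !lt_min rho10 ltr01 divr_gt0// invr_gt0.
exists (2 * (C0 * kap)); first by rewrite !mulr_ge0.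
move=> h; rewrite !le_min => /andP[h1 /andP[h2 h3]].
have idx' := idx1 _ h1; split => // {h1}.
have sol := state_diff_dae idx'.
have bx' := proj1 (is_state_dae T0 uC1 (stateP T0 uC1 idx')).
set x' := state T u (v + h) in bx' sol *.
set g := fun t => _ in sol.
have bg : mbounded T g by apply: mboundedD; apply: mbounded_mulmx => //;
  exact: mbounded_cst.
have bd : mbounded T (fun t => x' t - x t) by exact: mboundedB.
have [D0 D00 dD0] := mbounded_bound bd.
set z := `|h| in h2 h3 *.
have z0 : 0 <= z by exact: normr_ge0.
have thz : C0 * (n%:R * cA) * z <= 2^-1.
  apply: (@le_trans _ _ (th * z)); first by rewrite ler_wpM2r// lerDl.
  by move: h3; rewrite -[_ / 2]mulrC ler_pdivlMr// mulrC.
(* The source g contains the perturbed state x' itself, so the a priori bound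
   reads |x' - x| <= a + D / 2 whenever |x' - x| <= D; it is then iterated. *)
have step D : 0 <= D -> (forall t, t \in `[0, T] -> `|x' t - x t| <= D) ->
    forall t, t \in `[0, T] -> `|x' t - x t| <= C0 * kap * z + 2^-1 * D.
  move=> D0' hD t tT.
  apply: le_trans (apriori _ _ _ (kap * z + n%:R * cA * z * D) bg bd sol _ _ _ tT) _.
  - apply: le_trans (vx_le h) _; rewrite -/z; apply: (@le_trans _ _ (kap * z)).
      rewrite -[leLHS]mul1r ler_wpM2r// /kap lerDr.
      by apply: addr_ge0; do ?apply: mulr_ge0.
    by rewrite lerDl; do ?apply: mulr_ge0.
  - move=> y yT; apply: le_trans (ler_normD _ _) _.
    have gA : `|(matA (v + h) - A) *m x' y| <= n%:R * (cA * z) * (X + D).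
      apply: le_trans (mx_norm_mul _ _) _; rewrite -/n ler_pM ?mulr_ge0//.
        by rewrite ler_wpM2l// matA_Lipschitz.
      rewrite -[x' y](subrKC (x y)); apply: le_trans (ler_normD _ _) _.
      by apply: lerD; [exact: xX|exact: hD].
    have gB : `|vB h *m u y| <= m%:R * z * U.
      apply: le_trans (mx_norm_mul _ _) _; rewrite ler_pM ?mulr_ge0//; last exact: uU.
      by rewrite ler_wpM2l// vB_le.
    apply: le_trans (lerD gA gB) _; rewrite /kap; lra.
  - have -> : C0 * (kap * z + n%:R * cA * z * D) =
        C0 * kap * z + C0 * (n%:R * cA) * z * D by ring.
    by rewrite lerD2l ler_wpM2r.
pose a := C0 * kap * z.
have a0 : 0 <= a by rewrite !mulr_ge0.
have iter k t : t \in `[0, T] -> `|x' t - x t| <= 2 * a + D0 * 2^-1 ^+ k.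
  elim: k t => [|k IH] t tT.
    by rewrite mulr1; apply: le_trans (dD0 _ tT) _; rewrite lerDr mulr_ge0.
  apply: le_trans (step _ _ IH _ tT) _;
    first by rewrite addr_ge0// mulr_ge0// exprn_ge0.
  by rewrite -/a exprS; set q := 2^-1 ^+ k; lra.
move=> t tT; rewrite -subr_le0; apply: (@le0_half_expn _ _ D0) => k.
by have := iter k t tT; rewrite /a; set q := 2^-1 ^+ k; lra.
Qed.

End Perturbation.

(** * Quadratic remainder of the tracking cost *)

Section CostExpansion.
Context (R : realType) (T : R).
Hypothesis T0 : 0 < T.
Context (m r s : nat) (u yd : R -> 'cV[R]_m) (v : W R m r s).
Hypothesis uC1 : C1 T u.
Hypothesis Lyd : L2 T yd.
Hypothesis idx : index1 v.

Let n := (r + s)%N.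
Let TT : T \in `[0, T]. Proof. by rewrite in_itv/= lexx ltW. Qed.
Let A := matA v.
Let x := state T u v.
Let e t := (vB v)^T *m x t - yd t.
Let bu : mbounded T u. Proof. exact/mcont_mbounded/C1_mcont. Qed.
Let bx : mbounded T x. Proof. by have [] :=
  is_state_dae T0 uC1 (stateP T0 uC1 idx). Qed.

Lemma L2_misfit : L2 T e.
Proof.
apply: L2D => //; last exact: L2N.
by apply: mbounded_L2 => //; apply: mbounded_mulmx => //; exact: mbounded_cst.
Qed.

Let Le := L2_misfit.
Let ie := L2_L1 T0 Le.

Context (p : R -> 'cV[R]_(r + s)).
Hypothesis ip : L1 T p.
Hypothesis psol : dae_sol T true A^T (fun t => vB v *m e t) 0 p.

(** The components are the directions K, L, B and x_{1,0}. The transposed integral [xp] appears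
    because K enters also through K^T, and L through both factors of L L^T. *)
Definition gradJ1 : W R m r s :=
  let px := mint T (fun t => outer (p t) (x t)) in
  let xp := mint T (fun t => outer (x t) (p t)) in
  (px - xp, - ((px + xp) *m vL v),
   mint T (fun t => outer (p t) (u t) + outer (x t) (e t)), usubmx (p 0)).

Let Iouter a b (f : R -> 'cV[R]_a) (g : R -> 'cV[R]_b) : L1 T f -> mbounded T g ->
  L1 T (fun t => outer (f t) (g t)).
Proof. by move=> iF bG; apply: L1_mulmx => //; exact: mbounded_tr. Qed.

Let Iouterl a b (f : R -> 'cV[R]_a) (g : R -> 'cV[R]_b) : mbounded T f -> L1 T g ->
  L1 T (fun t => outer (f t) (g t)).
Proof. by move=> iF bG; apply: L1_mulmxl => //; exact: L1_tr. Qed.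

Lemma gradJ1E h : wdot gradJ1 h =
  sint T (fun t => frob (p t) (dmatA v h *m x t)) + sint T (fun t => frob (p t) (vB h
    *m u t))
  + sint T (fun t => frob (e t) ((vB h)^T *m x t)) + frob (usubmx (p 0)) (vx h).
Proof.
have ipx := Iouter ip bx; have ixp := Iouterl bx ip.
have ipu := Iouter ip bu; have ixe := Iouterl bx ie.
have E1 C : sint T (fun t => frob (p t) (C *m x t)) = frob (mint T (fun t => outer (p
  t) (x t))) C.
  by rewrite (mint_frob T0 TT _ ipx); apply: eq_sint => t _; rewrite frob_outer.
have E2 C : sint T (fun t => frob (p t) (C *m u t)) = frob (mint T (fun t => outer (p
  t) (u t))) C.
  by rewrite (mint_frob T0 TT _ ipu); apply: eq_sint => t _; rewrite frob_outer.
have E3 C : sint T (fun t => frob (e t) (C^T *m x t)) = frob (mint T (fun t => outer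
  (x t) (e t))) C.
  rewrite (mint_frob T0 TT _ ixe); apply: eq_sint => t _.
  by rewrite frob_outer frob_mull trmxK frobC.
have tpx : (mint T (fun t => outer (p t) (x t)))^T = mint T (fun t => outer (x t) (p
  t)).
  by rewrite -mint_tr; apply: eq_mint => t _; rewrite /outer trmx_mul trmxK.
rewrite E1 E2 E3 /wdot /gradJ1 /vK /vL /vB /vx/= (mintD TT ipu ixe) /dmatA.
rewrite -/(vK h) -/(vL h) -/(vL v).
set px := mint T (fun t => outer (p t) (x t)) in tpx *.
set xp := mint T (fun t => outer (x t) (p t)) in tpx *.
rewrite !frobDl !frobNl mulmxDl frobDl !frobBr frobDr.
rewrite (frob_mulr (vL v)^T) trmxK.
have -> : frob px (vK h)^T = frob xp (vK h) by rewrite -tpx -frob_tr trmxK.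
have -> : frob px (vL v *m (vL h)^T) = frob (xp *m vL v) (vL h).
  by rewrite -frob_tr trmx_mul trmxK tpx frob_mulr trmxK.
do 7!move: (frob _ _) => ?; ring.
Qed.

(** An exact identity. [d] is the change of the output B^T x, and the quadratic cost contributes the
    pairing of e with d and half of |d|^2. The part of the former that is driven by x' - x is
    rewritten by [duality]. Every term left on the right has two factors of order |h|. *)
Lemma J1_diff h : index1 (v + h) ->
  let x' := state T u (v + h) in
  let d := fun t => (vB v)^T *m (x' t - x t) + (vB h)^T *m x' t in
  J1 T u yd (v + h) - J1 T u yd v - wdot gradJ1 h =
    sint T (fun t => frob (p t) ((matA (v + h) - A) *m (x' t - x t)))
    - sint T (fun t => frob (p t) (vL h *m (vL h)^T *m x t))
    + sint T (fun t => frob (e t) ((vB h)^T *m (x' t - x t)))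
    + 2^-1 * sint T (fun t => frob (d t) (d t)).
Proof.
move=> idx' x' d.
have bx' : mbounded T x' := proj1 (is_state_dae T0 uC1 (stateP T0 uC1 idx')).
pose dl t := x' t - x t.
have bdl : mbounded T dl by exact: mboundedB.
have sol := state_diff_dae T0 uC1 idx idx'; rewrite -/x -/x' in sol.
set g := fun t => _ in sol.
have bC k q (C : 'M[R]_(k, q)) (z : R -> 'cV[R]_q) : mbounded T z ->
  mbounded T (fun t => C *m z t).
  by move=> bz; apply: mbounded_mulmx => //; exact: mbounded_cst.
have bg : mbounded T g by apply: mboundedD; exact: bC.
have bd : mbounded T d by apply: mboundedD; exact: bC.
have iG : L1 T (fun t => vB v *m e t) by apply: L1_mulmxl => //; exact: mbounded_cst.
have dual := duality T0 iG bg ip bdl psol sol.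
(* Not a product of an integrable and a bounded function: here the square integrability of the
   misfit is used directly. *)
have iee : sL1 T (fun t => frob (e t) (e t)).
  under eq_fun do rewrite frobE.
  apply: sL1_sum => // i; apply: sL1_sum => // j.
  by under eq_fun do rewrite -expr2; have /L2_sL2P[] := Le i j.
have ied : sL1 T (fun t => frob (e t) (d t)) by exact: sL1_frob.
have idd : sL1 T (fun t => frob (d t) (d t)) by apply: sL1_frob => //;
  exact: mbounded_L1.
have EJ : J1 T u yd (v + h) - J1 T u yd v =
    sint T (fun t => frob (e t) (d t)) + 2^-1 * sint T (fun t => frob (d t) (d t)).
  have -> : J1 T u yd (v + h) = 2^-1 * (sint T (fun t => frob (e t) (e t)) +
      2 * sint T (fun t => frob (e t) (d t)) + sint T (fun t => frob (d t) (d t))).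
    have i2 : sL1 T (fun t => 2 * frob (e t) (d t)) by apply: sL1Ml => //;
      exact: sbounded_cst.
    rewrite -(sintZl _ TT ied) -(sintD TT iee i2) -(sintD TT (sL1D iee i2) idd).
    congr (_ * _); apply: eq_sint => t _; rewrite fnorm_sqr -/x'.
    have -> : (vB (v + h))^T *m x' t - yd t = e t + d t.
      rewrite vBD /e /d linearD/= mulmxDl mulmxBr.
      set a := _^T *m x t; set b := _^T *m x' t; set c := _^T *m x' t.
      by clearbody a b c; apply/matrixP => i j; rewrite !mxE; ring.
    move: (e t) (d t) => a b; rewrite frobDl !frobDr [frob b a]frobC; ring.
  have -> : J1 T u yd v = 2^-1 * sint T (fun t => frob (e t) (e t)).
    by congr (_ * _); apply: eq_sint => t _; rewrite fnorm_sqr.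
  by do 3!move: (sint T _) => ?; lra.
have Eed : sint T (fun t => frob (e t) (d t)) =
    sint T (fun t => frob (vB v *m e t) (dl t)) + sint T (fun t => frob (e t) ((vB
      h)^T *m x' t)).
  rewrite -(sintD TT); [|exact: sL1_frob|by apply: sL1_frob => //; exact: bC].
  by apply: eq_sint => t _; rewrite /d frobDr frob_mull trmxK.
have Epg : sint T (fun t => frob (p t) (g t)) =
    sint T (fun t => frob (p t) ((matA (v + h) - A) *m dl t)) +
    (sint T (fun t => frob (p t) (dmatA v h *m x t)) -
     sint T (fun t => frob (p t) (vL h *m (vL h)^T *m x t))) +
    sint T (fun t => frob (p t) (vB h *m u t)).
  have iC k q (F : R -> 'cV[R]_q) (C : 'M[R]_(q, k)) (z : R -> 'cV[R]_k) : L1 T F ->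
    mbounded T z ->
    sL1 T (fun t => frob (F t) (C *m z t)) by move=> iF bz; apply: sL1_frob => //;
      exact: bC.
  rewrite -(sintB TT); [|exact: iC..].
  rewrite -(sintD TT); [|exact: iC|].
    rewrite -(sintD TT); [| |exact: iC].
      apply: eq_sint => t _; rewrite -frobBr -mulmxBl -matA_expand -!frobDr /g /dl.
      by rewrite -mulmxDr subrK.
    by apply: sL1D; [exact: iC|apply: sL1D; [exact: iC|apply: sL1N; exact: iC]].
  by apply: sL1D; [exact: iC|apply: sL1N; exact: iC].
have Eex : sint T (fun t => frob (e t) ((vB h)^T *m x' t)) =
    sint T (fun t => frob (e t) ((vB h)^T *m x t)) +
    sint T (fun t => frob (e t) ((vB h)^T *m dl t)).
  rewrite -(sintD TT); [|by apply: sL1_frob => //; exact: bC..].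
  by apply: eq_sint => t _; rewrite -frobDr -mulmxDr /dl subrKC.
rewrite EJ gradJ1E Eed dual Epg Eex /dl; move: (frob _ (vx h)) => ?.
do 7!move: (sint T _) => ?; ring.
Qed.

Lemma J1_expansion : exists2 rho, 0 < rho & exists C, forall h : W R m r s,
  `|h| <= rho ->
  `|J1 T u yd (v + h) - J1 T u yd v - wdot gradJ1 h| <= C * `|h| ^+ 2.
Proof.
have [rho rho0 [C C0 lip]] := state_Lipschitz T0 uC1 idx.
have [Cp Cp0 hCp] := frob_sint_bound T0 ip.
have [Ce Ce0 hCe] := frob_sint_bound T0 ie.
have [X X0 xX] := mbounded_bound bx.
pose cA : R := 2 + n%:R * `|vL v| + n%:R * `|vL v| + n%:R.
have cA0 : 0 <= cA by rewrite !addr_ge0// mulr_ge0.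
(* Lipschitz constant of the output; X + C bounds the perturbed state because |h| <= 1. *)
pose cd := n%:R * `|vB v| * C + n%:R * (X + C).
have cd0 : 0 <= cd by rewrite addr_ge0// mulr_ge0// ?addr_ge0// mulr_ge0.
exists (Num.min rho 1); first by rewrite lt_min rho0 ltr01.
exists (Cp * (n%:R * cA * C) + Cp * (n%:R * n%:R * X) + Ce * (n%:R * C)
  + 2^-1 * ((m * 1)%:R * (cd * cd) * T)).
move=> h; rewrite le_min => /andP[h1 h2].
have [idx' dC] := lip h h1.
have bx' := proj1 (is_state_dae T0 uC1 (stateP T0 uC1 idx')).
set x' := state T u (v + h) in bx' dC *; rewrite -/x in dC *.
have bC k q (B : 'M[R]_(k, q)) (z : R -> 'cV[R]_q) : mbounded T z ->
  mbounded T (fun t => B *m z t).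
  by move=> bz; apply: mbounded_mulmx => //; exact: mbounded_cst.
have bdl : mbounded T (fun t => x' t - x t) by exact: mboundedB.
have hA := matA_Lipschitz v h2; have hL := vL_le h; have hB := vB_le h.
set z := `|h| in h1 h2 dC hA hL hB *.
have z0 : 0 <= z by exact: normr_ge0.
have e1 : `|sint T (fun t => frob (p t) ((matA (v + h) - A) *m (x' t - x t)))|
    <= Cp * (n%:R * (cA * z) * (C * z)).
  apply: hCp => [||t tT]; [exact: bC|by do ?apply: mulr_ge0|].
  by apply: le_trans (mx_norm_mul _ _) _;
    rewrite -/n ler_pM ?mulr_ge0// ?dC// ler_wpM2l.
have e2 : `|sint T (fun t => frob (p t) (vL h *m (vL h)^T *m x t))|
    <= Cp * (n%:R * (n%:R * z * z) * X).
  apply: hCp => [||t tT]; [exact: bC|by do ?apply: mulr_ge0|].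
  apply: le_trans (mx_norm_mul _ _) _; rewrite -/n ler_pM ?mulr_ge0// ?xX// ler_wpM2l//.
  apply: le_trans (mx_norm_mul _ _) _; rewrite -/n mx_norm_tr ler_pM ?mulr_ge0//.
  by rewrite ler_wpM2l.
have e3 : `|sint T (fun t => frob (e t) ((vB h)^T *m (x' t - x t)))|
    <= Ce * (n%:R * z * (C * z)).
  apply: hCe => [||t tT]; [exact: bC|by do ?apply: mulr_ge0|].
  apply: le_trans (mx_norm_mul _ _) _; rewrite -/n mx_norm_tr ler_pM ?mulr_ge0// ?dC//.
  by rewrite ler_wpM2l.
pose d t := (vB v)^T *m (x' t - x t) + (vB h)^T *m x' t.
have hd t : t \in `[0, T] -> `|d t| <= cd * z.
  move=> tT; apply: le_trans (ler_normD _ _) _; rewrite /cd mulrDl; apply: lerD.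
    apply: le_trans (mx_norm_mul _ _) _; rewrite -/n mx_norm_tr -[leRHS]mulrA.
    by rewrite ler_wpM2l ?mulr_ge0// dC.
  apply: le_trans (mx_norm_mul _ _) _; rewrite -/n mx_norm_tr mulrAC.
  rewrite ler_pM ?mulr_ge0// ler_wpM2l//.
  rewrite -[x' t](subrKC (x t)); apply: le_trans (ler_normD _ _) _.
  rewrite lerD ?xX//; apply: le_trans (dC _ tT) _.
  by rewrite -[leRHS]mulr1 ler_wpM2l.
have bd : mbounded T d by apply: mboundedD; exact: bC.
have e4 : `|sint T (fun t => frob (d t) (d t))| <= (m * 1)%:R * (cd * z * (cd * z)) * T.
  rewrite -sint_cst; last exact: ltW.
  apply: (@le_sint _ T) => //.
  - by apply: sL1_frob => //; exact: mbounded_L1.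
  - exact/sbounded_sL1/sbounded_cst.
  - move=> t tT; apply: le_trans (frob_le _ _) _; rewrite ler_wpM2l//.
    by rewrite ler_pM// hd.
have -> : J1 T u yd (v + h) - J1 T u yd v - wdot gradJ1 h =
    sint T (fun t => frob (p t) ((matA (v + h) - A) *m (x' t - x t)))
    - sint T (fun t => frob (p t) (vL h *m (vL h)^T *m x t))
    + sint T (fun t => frob (e t) ((vB h)^T *m (x' t - x t)))
    + 2^-1 * sint T (fun t => frob (d t) (d t)) := J1_diff idx'.
apply: le_trans (ler_normD _ _) _.
rewrite [`|2^-1 * _|]normrM ger0_norm//.
rewrite [leRHS](_ : _ = Cp * (n%:R * (cA * z) * (C * z)) +
  Cp * (n%:R * (n%:R * z * z) * X) + Ce * (n%:R * z * (C * z)) +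
  2^-1 * ((m * 1)%:R * (cd * z * (cd * z)) * T)); last by ring.
apply: lerD; last by rewrite ler_wpM2l.
apply: le_trans (ler_normD _ _) _; apply: lerD => //.
by apply: le_trans (ler_normB _ _) _; exact: lerD.
Qed.

End CostExpansion.

(** * Gradients *)

Section Gradient.
Context (R : realType).

(** A quadratic remainder is stronger than differentiability, and it passes to sums and to
    coordinate directions by inspection. Linearity of l is supplied separately. *)
Definition qdiff (V : normedModType R) (f : V -> R) (x : V) (l : V -> R) :=
  exists2 rho, 0 < rho & exists C, forall h : V, `|h| <= rho ->
    `|f (x + h) - f x - l h| <= C * `|h| ^+ 2.

Lemma qdiffD (V : normedModType R) (f1 f2 : V -> R) x l1 l2 :
  qdiff f1 x l1 -> qdiff f2 x l2 ->
  qdiff (fun y => f1 y + f2 y) x (fun h => l1 h + l2 h).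
Proof.
move=> [r1 r10 [C1 H1]] [r2 r20 [C2 H2]].
exists (Num.min r1 r2); first by rewrite lt_min r10.
exists (C1 + C2) => h; rewrite le_min => /andP[h1 h2].
rewrite mulrDl (_ : _ - _ = (f1 (x + h) - f1 x - l1 h) + (f2 (x + h) - f2 x - l2 h));
  last by ring.
by apply: le_trans (ler_normD _ _) _; apply: lerD; [exact: H1|exact: H2].
Qed.

Lemma qdiff_diff (V : normedModType R) (f : V -> R) x (l : {linear V -> R}) c :
  (forall h, `|l h| <= c * `|h|) -> qdiff f x l -> 'd f x = l :> (V -> R).
Proof.
move=> lc [rho rho0 [C HC]]; apply: diff_unique.
  apply: bounded_linear_continuous; exists `|c|; split; first exact: num_real.
  move=> M cM; apply: filterS (nbhs0_le (ltr01 : (0 : R) < 1)) => h h1;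
    apply: le_trans (lc h) (le_trans _ (ltW cM)).
  apply: (@le_trans _ _ (`|c| * `|h|)); first by rewrite ler_wpM2r// ler_norm.
  by rewrite -[leRHS]mulr1 ler_wpM2l.
apply/eqaddoP => eps eps0 /=.
near=> h.
have -> : ((f \o shift x) - (cst (f x) + l)) h = f (x + h) - f x - l h.
  by rewrite !fctE /= [h + x]addrC opprD addrA.
apply: le_trans (HC _ _) _.
  by near: h; apply: nbhs0_le.
rewrite expr2 mulrA ler_wpM2r//.
(* The sign of C is unknown; |C| + 1 is a positive divisor. *)
apply: (@le_trans _ _ ((`|C| + 1) * `|h|)).
  by rewrite ler_wpM2r// (le_trans (ler_norm _))// lerDl.
rewrite -ler_pdivlMl; last by rewrite ltr_wpDl.
by near: h; apply: nbhs0_le; rewrite mulr_gt0// invr_gt0 ltr_wpDl.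
Unshelve. all: by end_near. Qed.

(** [grad] chooses by [get]. The element g shows that there is something to choose, and
    nondegeneracy of [dot] in its first argument that nothing else can be chosen. *)
Lemma grad_unique (V : normedModType R) (dot : V -> V -> R) f x g c :
  (forall a, linear (dot a : V -> R)) ->
  (forall h, `|dot g h| <= c * `|h|) ->
  (forall g1 g2, (forall h, dot g1 h = dot g2 h) -> g1 = g2) ->
  qdiff f x (dot g) -> grad dot f x = g.
Proof.
move=> lin gc inj qd.
pose l : {linear V -> R} := HB.pack (dot g) (GRing.isLinear.Build R V R _ (dot g)
  (lin g)).
have dE := @qdiff_diff V f x l c gc qd.
apply: inj => h; rewrite -[RHS]/(l h) -dE; apply/esym; move: h.
apply: (@getPex _ [set g : V | forall h : V, 'd f x h = dot g h]).
by exists g => h; rewrite dE.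
Qed.

End Gradient.

(** * Full and partial gradients on the parameter space *)

Section PartialGradients.
Context (R : realType) (m r s : nat).
Implicit Types (v w g h : W R m r s).

Lemma frob_linear p q (A : 'M[R]_(p, q)) : linear (frob A : 'M[R]_(p, q) -> R).
Proof. by move=> k B C; rewrite frobDr frobZr. Qed.

Lemma frob_inj p q (A B : 'M[R]_(p, q)) : (forall C, frob A C = frob B C) -> A = B.
Proof.
move=> H; apply/eqP; rewrite -subr_eq0; apply/eqP/frob_eq0.
by rewrite frobBl H subrr.
Qed.

Lemma grad_frob p q (f : 'M[R]_(p, q) -> R) X G : qdiff f X (frob G) ->
  grad (@frob R p q) f X = G.
Proof.
apply: (@grad_unique _ _ _ _ _ _ ((p * q)%:R * `|G|)).
- exact: frob_linear.
- by move=> h; rewrite -mulrA frob_le.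
- exact: frob_inj.
Qed.

Lemma wdot_linear w : linear (wdot w : W R m r s -> R).
Proof.
move=> k B C; rewrite /wdot vKD vLD vBD vxD.
have Z (z : W R m r s) : [/\ vK (k *: z) = k *: vK z, vL (k *: z) = k *: vL z,
  vB (k *: z) = k *: vB z & vx (k *: z) = k *: vx z] by [].
have [-> -> -> ->] := Z B.
by rewrite !frobDr !frobZr /GRing.scale/=; do 8!move: (frob _ _) => ?; ring.
Qed.

Lemma wdotDl w1 w2 h : wdot (w1 + w2) h = wdot w1 h + wdot w2 h.
Proof.
by rewrite /wdot vKD vLD vBD vxD !frobDl; do 8!move: (frob _ _) => ?; ring.
Qed.

Lemma wdotC w1 w2 : wdot w1 w2 = wdot w2 w1.
Proof.
by rewrite /wdot [frob (vK w1) _]frobC [frob (vL w1) _]frobC [frob (vB w1) _]frobC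
  [frob (vx w1) _]frobC.
Qed.

Lemma wdotDr w1 w2 h : wdot h (w1 + w2) = wdot h w1 + wdot h w2.
Proof. by rewrite wdotC wdotDl ![wdot h _]wdotC. Qed.

Lemma wdot_ge0 w : 0 <= wdot w w.
Proof. by rewrite /wdot !addr_ge0// frob_ge0. Qed.

Lemma wnorm_sqr w : wnorm w ^+ 2 = wdot w w.
Proof. by rewrite /wnorm sqr_sqrtr// wdot_ge0. Qed.

Definition wdot_cst : R := ((r + s) * (r + s))%:R + ((r + s) * (r + s))%:R
  + ((r + s) * m)%:R + (r * 1)%:R.

Lemma wdot_cst_ge0 : 0 <= wdot_cst.
Proof. by rewrite /wdot_cst !addr_ge0. Qed.

Lemma wdot_le w h : `|wdot w h| <= wdot_cst * (`|w| * `|h|).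
Proof.
have F p q (A B : 'M[R]_(p, q)) : `|A| <= `|w| -> `|B| <= `|h| ->
    `|frob A B| <= (p * q)%:R * (`|w| * `|h|).
  by move=> Aw Bh; apply: le_trans (frob_le _ _) _; rewrite ler_wpM2l// ler_pM.
rewrite /wdot /wdot_cst !mulrDl.
apply: le_trans (ler_normD _ _) _; apply: lerD; last by apply: F; exact: vx_le.
apply: le_trans (ler_normD _ _) _; apply: lerD; last by apply: F; exact: vB_le.
apply: le_trans (ler_normD _ _) _; apply: lerD; last by apply: F; exact: vL_le.
by apply: F; exact: vK_le.
Qed.

Lemma wdot_inj w1 w2 : (forall h, wdot w1 h = wdot w2 h) -> w1 = w2.
Proof.
case: w1 => [[[K1 L1] B1] x1]; case: w2 => [[[K2 L2'] B2] x2] H.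
congr (_, _, _, _); apply: frob_inj => C.
- by have := H (C, 0, 0, 0); rewrite /wdot/= !frob0r !addr0.
- by have := H (0, C, 0, 0); rewrite /wdot/= !frob0r !addr0 !add0r.
- by have := H (0, 0, C, 0); rewrite /wdot/= !frob0r !addr0 !add0r.
- by have := H (0, 0, 0, C); rewrite /wdot/= !frob0r !add0r.
Qed.

Lemma grad_wdot (f : W R m r s -> R) v g : qdiff f v (wdot g) ->
  grad (@wdot R m r s) f v = g.
Proof.
apply: (@grad_unique _ _ _ _ _ _ (wdot_cst * `|g|)).
- exact: wdot_linear.
- by move=> h; rewrite -mulrA wdot_le.
- exact: wdot_inj.
Qed.

Lemma W_normE (K L : 'M[R]_(r + s)) (B : 'M[R]_(r + s, m)) (x : 'cV[R]_r) :
  `|(K, L, B, x) : W R m r s| = Num.max (Num.max (Num.max `|K| `|L|) `|B|) `|x|.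
Proof. by []. Qed.

(** W carries the maximum norm of its factors, so (h, 0, 0, 0) has the norm of h and the expansion
    on W restricts with the same radius and constant. The other three components behave alike. *)
Lemma gradK_qdiff f v g : qdiff f v (wdot g) -> gradK f v = vK g.
Proof.
case: v => [[[K L] B] x] [rho rho0 [C H]]; apply: grad_frob; exists rho => //.
exists C => h hr; have nh : `|(h, 0, 0, 0) : W R m r s| = `|h|.
  by rewrite W_normE !normr0 !max_l.
have := H (h, 0, 0, 0); rewrite nh => /(_ hr).
rewrite /wdot/= !frob0r !addr0; congr (_ <= _); congr (`|f _ - _ - _|).
by congr (_, _, _, _); rewrite /= addr0.
Qed.

Lemma gradL_qdiff f v g : qdiff f v (wdot g) -> gradL f v = vL g.
Proof.
case: v => [[[K L] B] x] [rho rho0 [C H]]; apply: grad_frob; exists rho => //.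
exists C => h hr; have nh : `|(0, h, 0, 0) : W R m r s| = `|h|.
  by rewrite W_normE !normr0 (max_r (normr_ge0 h)) !max_l.
have := H (0, h, 0, 0); rewrite nh => /(_ hr).
rewrite /wdot/= !frob0r !addr0 add0r; congr (_ <= _); congr (`|f _ - _ - _|).
by congr (_, _, _, _); rewrite /= addr0.
Qed.

Lemma gradB_qdiff f v g : qdiff f v (wdot g) -> gradB f v = vB g.
Proof.
case: v => [[[K L] B] x] [rho rho0 [C H]]; apply: grad_frob; exists rho => //.
exists C => h hr; have nh : `|(0, 0, h, 0) : W R m r s| = `|h|.
  by rewrite W_normE !normr0 maxxx (max_r (normr_ge0 h)) (max_l (normr_ge0 h)).
have := H (0, 0, h, 0); rewrite nh => /(_ hr).
rewrite /wdot/= !frob0r !addr0 !add0r; congr (_ <= _); congr (`|f _ - _ - _|).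
by congr (_, _, _, _); rewrite /= addr0.
Qed.

Lemma gradx_qdiff f v g : qdiff f v (wdot g) -> gradx f v = vx g.
Proof.
case: v => [[[K L] B] x] [rho rho0 [C H]]; apply: grad_frob; exists rho => //.
exists C => h hr; have nh : `|(0, 0, 0, h) : W R m r s| = `|h|.
  by rewrite W_normE !normr0 !maxxx max_r.
have := H (0, 0, 0, h); rewrite nh => /(_ hr).
rewrite /wdot/= !frob0r !add0r; congr (_ <= _); congr (`|f _ - _ - _|).
by congr (_, _, _, _); rewrite /= addr0.
Qed.

(** * Gradient of the regularization term *)

Section Regularization.
Context (lam : R) (wref v : W R m r s).

Let a := w_of v - wref.

(** The adjoint of the derivative of [w_of] at v, applied to lam times the residual [a]. *)
Definition gradJ2 : W R m r s :=
  lam *: (vK a - (vK a)^T, (vL a + (vL a)^T) *m vL v, vB a, vx a).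

Lemma J2_qdiff : qdiff (J2 lam wref) v (wdot gradJ2).
Proof.
pose n : R := (r + s)%:R; pose k : R := 2 + n * `|vL v| + n * `|vL v| + n.
(* [w_of] is a polynomial map of degree two: [D] is its derivative at v, and [Q], coming from L L^T
   alone, the whole remainder. *)
pose D h : W R m r s := (vK h - (vK h)^T, vL h *m (vL v)^T + vL v *m (vL h)^T, vB h,
  vx h).
pose Q h : W R m r s := (0, vL h *m (vL h)^T, 0, 0).
have n0 : 0 <= n by [].
have tD (b c : 'M[R]_(r + s)) : (b + c)^T = b^T + c^T by rewrite linearD.
have wE h : w_of (v + h) - wref = a + (D h + Q h).
  have -> : w_of (v + h) = w_of v + (D h + Q h).
    rewrite /w_of /D /Q vKD vLD vBD vxD.
    congr (_, _, _, _); rewrite /= ?addr0//.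
      by rewrite tD opprD addrACA.
    by rewrite tD mulmxDl !mulmxDr -!addrA; congr (_ + _); rewrite addrCA.
  by rewrite addrAC.
have DE h : lam * wdot a (D h) = wdot gradJ2 h.
  have -> : wdot a (D h) = frob (vK a) (vK h - (vK h)^T) +
    frob (vL a) (vL h *m (vL v)^T + vL v *m (vL h)^T) +
    frob (vB a) (vB h) + frob (vx a) (vx h) by [].
  have -> : wdot gradJ2 h = frob (lam *: (vK a - (vK a)^T)) (vK h) +
    frob (lam *: ((vL a + (vL a)^T) *m vL v)) (vL h) +
    frob (lam *: vB a) (vB h) + frob (lam *: vx a) (vx h) by [].
  move: (vK a) (vL a) (vB a) (vx a) (vK h) (vL h) (vL v) (vB h) (vx h).
  move=> aK aL aB ax hK hL L hB hx.
  rewrite !frobZl frobBr frobBl frobDr mulmxDl frobDl.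
  have -> : frob aK hK^T = frob aK^T hK by rewrite -frob_tr trmxK.
  have -> : frob aL (L *m hL^T) = frob (aL^T *m L) hL.
    by rewrite -frob_tr trmx_mul trmxK frob_mulr trmxK.
  rewrite (frob_mulr L^T) trmxK.
  by do 6!move: (frob _ _) => ?; ring.
have QE h : `|h| <= 1 -> `|Q h| <= n * `|h| ^+ 2.
  move=> h1; rewrite /Q W_normE !normr0 (max_r (normr_ge0 _)) !max_l//.
  apply: le_trans (mx_norm_mul _ _) _; rewrite mx_norm_tr -mulrA -expr2 ler_wpM2l//.
  by rewrite lerXn2r ?nnegrE// vL_le.
have DQ h : `|h| <= 1 -> `|D h + Q h| <= k * `|h|.
  move=> h1; have hK := vK_le h; have hL := vL_le h; have hB := vB_le h;
    have hx := vx_le h.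
  set z := `|h| in h1 hK hL hB hx *.
  have z0 : 0 <= z by exact: normr_ge0.
  have nL0 : 0 <= n * `|vL v| by rewrite mulr_ge0.
  have l1 : `|vL h *m (vL v)^T| <= n * `|vL v| * z.
    apply: le_trans (mx_norm_mul _ _) _; rewrite mx_norm_tr mulrAC.
    by rewrite ler_wpM2l.
  have l2 : `|vL v *m (vL h)^T| <= n * `|vL v| * z.
    by apply: le_trans (mx_norm_mul _ _) _; rewrite mx_norm_tr ler_wpM2l.
  have l3 : `|vL h *m (vL h)^T| <= n * z.
    apply: le_trans (mx_norm_mul _ _) _; rewrite mx_norm_tr -mulrA ler_wpM2l//.
    by rewrite -[leRHS]mulr1 ler_pM// (le_trans hL).
  have kz : z <= k * z /\ z + z <= k * z /\
      n * `|vL v| * z + n * `|vL v| * z + n * z <= k * z.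
    rewrite -!mulrDl -[X in X <= _ /\ _]mul1r; do !split.
    - by rewrite ler_wpM2r// /k; lra.
    - by rewrite -[X in X + X]mul1r -mulrDl ler_wpM2r// /k; lra.
    - by rewrite ler_wpM2r// /k; lra.
  case: kz => kz1 [kz2 kz3].
  rewrite /D /Q -[_ + _]/(_, _, _, _) W_normE !ge_max/= !addr0.
  apply/andP; split; last exact: le_trans kz1.
  apply/andP; split; last exact: le_trans kz1.
  apply/andP; split.
    apply: le_trans (ler_normB _ _) _; rewrite mx_norm_tr; apply: le_trans kz2.
    exact: lerD.
  apply: le_trans kz3; apply: le_trans (ler_normD _ _) _; apply: lerD => //.
  by apply: le_trans (ler_normD _ _) _; exact: lerD.
exists 1 => //.
exists (`|lam| * (wdot_cst * (`|a| * n)) + `|lam / 2| * (wdot_cst * (k * k))) => h h1.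
rewrite -DE /J2 !wnorm_sqr wE -/a.
have -> : lam / 2 * wdot (a + (D h + Q h)) (a + (D h + Q h)) - lam / 2 * wdot a a -
  lam * wdot a (D h)
   = lam * wdot a (Q h) + lam / 2 * wdot (D h + Q h) (D h + Q h).
  move: (D h) (Q h) => x y; rewrite wdotDl !(wdotDr _ _ a) wdotDr [wdot (x + y)
    a]wdotC wdotDr.
  by move: (wdot (x + y) (x + y)) => ?; move: (wdot a a) (wdot a x) (wdot a y) => *;
    field.
apply: le_trans (ler_normD _ _) _; rewrite mulrDl; apply: lerD.
  rewrite [leLHS]normrM -[leRHS]mulrA ler_wpM2l//; apply: le_trans (wdot_le _ _) _.
  rewrite -!mulrA ler_wpM2l ?wdot_cst_ge0// ler_wpM2l//; exact: QE.
rewrite [leLHS]normrM -[leRHS]mulrA ler_wpM2l//; apply: le_trans (wdot_le _ _) _.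
rewrite -[leRHS]mulrA ler_wpM2l ?wdot_cst_ge0//.
by rewrite expr2 mulrACA ler_pM// DQ.
Qed.

End Regularization.

End PartialGradients.

Theorem theorem5 (R : realType) (m r s : nat)
    (hm : (1 <= m)%N) (hr : (1 <= r)%N)
    (T lam : R) (hT : 0 < T) (hlam : 0 <= lam)
    (u : R -> 'cV[R]_m) (hu : C1 T u)
    (ydata : R -> 'cV[R]_m) (hydata : L2 T ydata)
    (wref vbar : W R m r s) (hidx : index1 vbar)
    (hstat : stationary (Jhat T lam u ydata wref) vbar) :
  exists (xbar pbar : R -> 'cV[R]_(r + s)) (ybar : R -> 'cV[R]_m),
    [/\ is_state T u vbar xbar,
        (forall t, ybar t = (vB vbar)^T *m xbar t)
      & is_adjoint T ydata vbar ybar pbar] /\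
    [/\ 0 = gradK (Jhat T lam u ydata wref) vbar /\
        gradK (Jhat T lam u ydata wref) vbar =
          gradK (J2 lam wref) vbar
          + mint T (fun t => outer (pbar t) (xbar t))
          - mint T (fun t => outer (xbar t) (pbar t)),
        0 = gradL (Jhat T lam u ydata wref) vbar /\
        gradL (Jhat T lam u ydata wref) vbar =
          gradL (J2 lam wref) vbar
          - (mint T (fun t => outer (pbar t) (xbar t))
             + mint T (fun t => outer (xbar t) (pbar t))) *m vL vbar,
        0 = gradB (J2 lam wref) vbar
          + mint T (fun t => outer (pbar t) (u t)
                             + outer (xbar t) (ybar t - ydata t))
      & 0 = gradx (J2 lam wref) vbar + usubmx (pbar 0)].
Proof.
have xsol := stateP hT hu hidx.
have [p [padj ip _ psol]] := adjoint_exists hT hidx (L2_misfit hT hu hydata hidx).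
pose g1 := gradJ1 T u ydata vbar p; pose g2 := gradJ2 lam wref vbar.
have q2 : qdiff (J2 lam wref) vbar (wdot g2) := J2_qdiff lam wref vbar.
have q : qdiff (Jhat T lam u ydata wref) vbar (wdot (g1 + g2)).
  have q1 : qdiff (J1 T u ydata) vbar (wdot g1) :=
    J1_expansion hT hu hydata hidx ip psol.
  by have := qdiffD q1 q2; rewrite (_ : wdot (g1 + g2) = (fun h => wdot g1 h + wdot
    g2 h))//;
    apply/funext => h; exact: wdotDl.
(* The full gradient is g1 + g2, and stationarity makes it vanish. Each of the four conditions is
   one component of this equation. *)
have g0 : g1 + g2 = 0 by rewrite -(grad_wdot q).
exists (state T u vbar), p, (fun t => (vB vbar)^T *m state T u vbar t); split;
  first by split.
rewrite (gradK_qdiff q) (gradL_qdiff q) (gradK_qdiff q2) (gradL_qdiff q2).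
rewrite (gradB_qdiff q2) (gradx_qdiff q2).
split.
- split; first by rewrite g0.
  by rewrite -addrA addrC.
- split; first by rewrite g0.
  by rewrite addrC.
- by rewrite addrC; have := congr1 (@vB R m r s) g0.
- by rewrite addrC; have := congr1 (@vx R m r s) g0.
Qed.
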